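(* For every sufficiently small $\varepsilon>0$ there exists $\alpha>1$ such that the following holds. If $\lambda_0\in[0,8]$, $\bar V\ge2$ and $Q\subset\mathbb Z^2$ is a box of side length $L\ge\alpha$, then $\mathbb P[\mathcal E]\ge1-\exp(-\varepsilon L^{2/3})$, where $\mathcal E$ denotes the event that $$\left|\left\{a\in Q:|u(a)|\ge(\bar VL)^{-\alpha L}\|u\|_{\ell^\infty(\frac{Q}{100})}\right\}\right|\ge\varepsilon^3L^2$$ holds whenever $\lambda\in\mathbb R$, $u:\mathbb Z^2\to\mathbb R$, $|\lambda-\lambda_0|\le(\bar VL)^{-\alpha L}$ and $Hu=\lambda u$ in $Q$.
   Context: For $a\in\mathbb Z^2$, $|a|=\|a\|_\infty$; $a\sim b$ means $\|a-b\|_1=1$. $H=-\Delta+V$ with $\Delta u(a)=-4u(a)+\sum_{b\sim a}u(b)$, and $\{V(a)\}_{a\in\mathbb Z^2}$ i.i.d. with $\mathbb P[V(a)=0]=\mathbb P[V(a)=\bar V]=\frac12$. For real $l\ge1$, $Q_l(a)=\{a'\in\mathbb Z^2:|a-a'|\le\frac{l-1}{2}\}$ is a box with side length $\ell(Q_l(a))=2\lfloor\frac{l-1}{2}\rfloor$; for real $k>0$, $kQ_l(a)=Q_{kl}(a)$, and $\frac{Q}{100}=\frac1{100}Q$. ''$Hu=\lambda u$ in $Q$'' means $(Hu)(a)=\lambda u(a)$ for every $a\in Q$. *)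

(* Defs.v *)
From HB Require Import structures.
From mathcomp Require Import all_boot all_order all_algebra.
From mathcomp Require Import finmap.
From mathcomp Require Import all_classical all_reals all_analysis.

Set Implicit Arguments.
Unset Strict Implicit.
Unset Printing Implicit Defensive.

Import Order.TTheory GRing.Theory Num.Theory.
Import numFieldNormedType.Exports.

Local Open Scope classical_set_scope.
Local Open Scope ring_scope.

Notation site := (int * int)%type.

Definition norm_inf (a : site) : int := Num.max `|a.1| `|a.2|.

Definition norm_one (a : site) : int := `|a.1| + `|a.2|.

Definition neighbor (a b : site) : Prop := norm_one (a - b) = 1.

(* [Q_l(a)]; for [l < 1] it is empty, as it may be for a dilate [k * l]. *)
Definition box (R : realType) (l : R) (a : site) : set site :=
  [set b | (norm_inf (a - b))%:~R <= (l - 1) / 2].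

(* The side length of [Q_l(a)] is this even integer, which differs from [l]. *)
Definition side_length (R : realType) (l : R) : R :=
  (2 * Num.floor ((l - 1) / 2))%:~R.

Definition laplacian (R : realType) (u : site -> R) (a : site) : R :=
  - 4 * u a + \sum_(b \in [set b | neighbor a b]) u b.

(* [H = - laplacian + v] for a realization [v] of the potential. *)
Definition hamiltonian (R : realType) (v u : site -> R) (a : site) : R :=
  - laplacian u a + v a * u a.

(* Only used on finite sets, so the supremum is a maximum; it is 0 on [set0]. *)
Definition linf_norm (R : realType) (A : set site) (u : site -> R) : R :=
  sup [set `|u a| | a in A].

(* [fset_set] sends infinite sets to the empty one; here boxes are finite. *)
Definition num_large (R : realType) (A : set site) (u : site -> R) (t : R) : nat :=
  #|` fset_set [set a | A a /\ t <= `|u a|] |.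

Definition mutually_independent d (T : measurableType d) (R : realType)
    (P : probability T R) (I : choiceType) (X : I -> {RV P >-> R}) : Prop :=
  forall (s : seq I) (B : I -> set R),
    uniq s -> (forall i, i \in s -> measurable (B i)) ->
    P (\bigcap_(i in [set` s]) (X i @^-1` B i)) =
    (\prod_(i <- s) P (X i @^-1` B i))%E.

(* The two point probabilities add up to 1, so they determine the common law. *)
Definition bernoulli_potential d (T : measurableType d) (R : realType)
    (P : probability T R) (Vbar : R) (V : site -> {RV P >-> R}) : Prop :=
  mutually_independent V /\
  forall a, P (V a @^-1` [set 0]) = (2^-1)%:E /\
            P (V a @^-1` [set Vbar]) = (2^-1)%:E.

Definition unique_continuation d (T : measurableType d) (R : realType)
    (P : probability T R) (V : site -> {RV P >-> R})
    (eps alpha lambda0 Vbar l : R) (a : site) : set T :=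
  let L := side_length l in
  let delta := (Vbar * L) `^ (- (alpha * L)) in
  [set w | forall (lambda : R) (u : site -> R),
    `|lambda - lambda0| <= delta ->
    (forall b, box l a b ->
       hamiltonian (fun c => V c w) u b = lambda * u b) ->
    eps ^+ 3 * L ^+ 2 <=
      (num_large (box l a) u
         (delta * linf_norm (box (l / 100) a) u))%:R].

(* Main.v *)
Require Import Defs.
From mathcomp Require Import all_boot all_order all_algebra.
From mathcomp Require Import finmap.
From mathcomp Require Import all_classical all_reals all_analysis.
From mathcomp Require Import ring lra zify.

Set Implicit Arguments.
Unset Strict Implicit.
Unset Printing Implicit Defensive.

Import Order.TTheory GRing.Theory Num.Theory.
Import numFieldNormedType.Exports.

(** The theorem says that an approximate eigenfunction cannot live on a small
    proportion of the box: writing [L] for the side length, if [|u| < 1] outside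
    a small enough proportion of [Q], then [|u| <= (Vbar * L) ^ (C * L)] near
    the centre, with large probability. Constants are absolute here; the
    given [eps] only has to lie below one of them, and [alpha] is one of them.

    Growth. In the coordinates [x + y] and [x - y] the equation expresses the
    sum of the values at the four diagonal neighbours of a site by the value at
    the site. On a rectangle in these coordinates, two full rows together with one
    value in each further row determine [u], and each row costs a factor [G]
    of order [(Vbar * L) ^ 2]. So a bound on two rows propagates as long as
    each further row contains one site where [u] is small. The obstruction is a
    row on which [u] is large everywhere, alternating in sign.

    Randomness. Suppose that such a row [t] is dominant and that a later row [T]
    with [T - t] odd has few large sites ([bounded_or_exceptional]). Solving
    the equation sideways in the strip between rows [t] and [T] shows that,
    up to tiny errors, [u] depends linearly on about [T] plus the number of large
    sites of row [T] parameters, through coefficients that do not see the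
    potential on row [t] ([row_to_strip_bound]). On the other hand, the potential
    at a site of row [t] can be read off from the sign of a linear expression in
    [u] at its neighbours. A space of dimension [D] realizes at most
    [sum_(k <= D) 'C(n, k)] sign patterns on [n] coordinates, so only that many
    of the [2 ^ n] configurations of row [t] are possible
    ([card_exceptional]). Counting signs in place of discretizing [u] lets [D] be
    a fixed proportion of [n], which is what makes the final density positive.

    Scales. Four rectangles enlarge an l1-ball by a fixed proportion
    ([ball_growth]); over all scales the losses add up to an exponent linear in
    [L] ([tower_bound]). This works around a centre unless the large sites are
    dense in some concentric ball, which by a covering argument excludes few
    centres ([vitali]), or a rectangle fails, which at radius [rho] has
    probability at most [(9 / 10) ^ rho]. For [rho >= r], with [r] of order
    [L ^ (2 / 3)], the union bound rules out any failure with large probability.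
    For [rho < r] failures do occur, but in separated blocks of size [r] they are
    independent, and there are of order [(L / r) ^ 2], that is
    [L ^ (2 / 3)], blocks: most of the centres of half of the blocks fail only
    with probability exponentially small in the number of blocks
    ([pr_config_fails]). Hence some centre survives both exclusions
    ([good_config_bound]). *)

Local Open Scope ring_scope.

(** The preprocessing of [lia] is slow on hypotheses about an abstract ordered
    field; [int_lia] and [nat_lia] drop those that cannot matter. *)
Ltac drop_real_order x H :=
  let t := type of x in tryif unify t int then fail else clear H.

Ltac int_lia :=
  repeat match goal with
  | H : forall _, _ |- _ => clear H
  | H : is_true (@Order.le _ _ ?x _) |- _ => drop_real_order x H
  | H : is_true (@Order.lt _ _ ?x _) |- _ => drop_real_order x H
  | H : is_true (@Order.le _ _ ?x _ && _) |- _ => drop_real_order x H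
  | H : is_true (_ \notin _) |- _ => clear H
  | H : is_true (_ \in _) |- _ => clear H
  end; lia.

Ltac nat_lia :=
  repeat match goal with
  | H : forall _, _ |- _ => clear H
  | H : is_true (@Order.le _ _ _ _) |- _ => clear H
  | H : is_true (@Order.lt _ _ _ _) |- _ => clear H
  | H : _ /\ _ |- _ => clear H
  | H : @eq (GRing.Nmodule.sort _) _ _ |- _ => clear H
  | X := _ : GRing.Nmodule.sort _ |- _ => clear X
  end; lia.

(** * Sign patterns of a linear space *)

(** Finitely many strict inequalities survive a small enough perturbation. *)
Lemma small_perturbation (R : realFieldType) (T : eqType) (l m : T -> R) (s : seq T) :
  (forall x, x \in s -> 0 < l x) ->
  exists2 tau, 0 < tau & forall x, x \in s -> 0 < l x + tau * m x.
Proof.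
elim: s => [|x0 s IHs] pos; first by exists 1.
have [|tau tau0 Htau] := IHs; first by move=> x xs; apply: pos; rewrite inE xs orbT.
have l0 : 0 < l x0 by apply: pos; rewrite mem_head.
have m0 : 0 < 1 + `|m x0| by rewrite ltr_pwDl.
exists (Num.min tau (l x0 / (1 + `|m x0|))).
  by rewrite lt_min tau0 divr_gt0.
set t := Num.min _ _.
have t0 : 0 < t by rewrite lt_min tau0 divr_gt0.
have [t1 t2] : t <= tau /\ t <= l x0 / (1 + `|m x0|).
  by split; rewrite ge_min lexx ?orbT.
move=> x; rewrite inE => /orP[/eqP->|xs].
  have : t * (1 + `|m x0|) <= l x0 by rewrite -ler_pdivlMr.
  have : - (t * `|m x0|) <= t * m x0.
    by rewrite -mulrN ler_pM2l// lerNl ler_normr lexx orbT.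
  by lra.
have lx : 0 < l x by apply: pos; rewrite inE xs orbT.
have := Htau x xs; case: (lerP 0 (m x)) => mx.
  by move=> _; rewrite ltr_pwDl// mulr_ge0// ltW.
move=> H; apply: lt_le_trans H _; rewrite lerD2l.
by rewrite ler_nM2r.
Qed.

Lemma entryB (R : pzRingType) m n (A B : 'M[R]_(m, n)) c i j :
  (A - c *: B) i j = A i j - c * B i j.
Proof. by rewrite !mxE. Qed.

Lemma entryD (R : pzRingType) m n (A B : 'M[R]_(m, n)) c d i j :
  (c *: A + d *: B) i j = c * A i j + d * B i j.
Proof. by rewrite !mxE. Qed.

(** Gordan's theorem of the alternative. By induction on [s]: if a functional [h]
    works for [s] but is negative at [x0], project the vectors along [f x0]
    to the kernel of [h]; a relation between the projections is one between the
    vectors, because the weight it gives to [f x0] is nonnegative. *)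
Lemma gordan (R : realFieldType) (T : eqType) D (f : T -> 'rV[R]_D) (s : seq T) :
  uniq s ->
  (exists h : 'cV[R]_D, forall x, x \in s -> 0 < (f x *m h) 0 0) \/
  (exists g : T -> R, [/\ forall x, 0 <= g x, exists2 x, x \in s & 0 < g x &
     \sum_(x <- s) g x *: f x = 0]).
Proof.
elim: s f => [|x0 s IHs] f /=; first by left; exists 0.
case/andP => x0s us.
have relU (g : T -> R) c : \sum_(x <- x0 :: s) (if x == x0 then c else g x) *: f x
    = c *: f x0 + \sum_(x <- s) g x *: f x.
  rewrite big_cons eqxx; congr (_ + _); rewrite !big_seq; apply: eq_bigr => x xs.
  by case: eqP => // xx0; rewrite -xx0 xs in x0s.
have gtU (g : T -> R) c : (exists2 x, x \in s & 0 < g x) ->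
    exists2 x, x \in x0 :: s & 0 < (if x == x0 then c else g x).
  case=> x xs gx; exists x; first by rewrite inE xs orbT.
  by case: eqP => // xx0; rewrite -xx0 xs in x0s.
case: (IHs f us) => [[h Hh]|[g [g0 gs gr]]]; last first.
  right; exists (fun x => if x == x0 then 0 else g x); split.
  - by move=> x; case: ifP.
  - exact: gtU.
  - by rewrite relU scale0r add0r.
pose l x := (f x *m h) 0 0.
case: (ltrgtP (l x0) 0) => [lx0|lx0|lx0].
- pose c x := l x / l x0.
  have cs x : x \in s -> c x < 0.
    by move=> xs; rewrite /c pmulr_rlt0 ?invr_lt0// Hh.
  case: (IHs (fun x => f x - c x *: f x0) us) => [[h' Hh']|[g [g0 gs gr]]].
    pose d := (f x0 *m h') 0 0 / l x0.
    pose h2 := h' - d *: h.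
    have h2x x : (f x *m h2) 0 0 = (f x *m h') 0 0 - d * l x.
      by rewrite mulmxBr -scalemxAr entryB.
    have h2s x : x \in s -> 0 < (f x *m h2) 0 0.
      move=> xs; have := Hh' x xs; rewrite h2x mulmxBl -scalemxAl entryB.
      suff -> : d * l x = c x * (f x0 *m h') 0 0 by [].
      by rewrite /d /c; ring.
    have [tau tau0 Htau] := small_perturbation (fun x => - l x) h2s.
    left; exists (h2 - tau *: h) => x; rewrite inE => xs.
    rewrite mulmxBr -scalemxAr entryB -/(l x).
    case/orP: xs => [/eqP->|xs]; last by rewrite -mulrN Htau.
    rewrite h2x /d divfK ?lt_eqF// subrr add0r -mulrN.
    by rewrite mulr_gt0// oppr_gt0.
  right; exists (fun x => if x == x0 then - \sum_(x <- s) g x * c x else g x); split.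
  - move=> x; case: ifP => // _; rewrite -sumrN big_seq.
    by apply: sumr_ge0 => y ys; rewrite -mulrN mulr_ge0// oppr_ge0 ltW// cs.
  - exact: gtU.
  - rewrite relU -[RHS]gr.
    under [in RHS]eq_bigr do rewrite scalerBr scalerA.
    by rewrite sumrB scaleNr scaler_suml addrC.
- by left; exists h => x; rewrite inE => /orP[/eqP->|/Hh].
case: (eqVneq (f x0) 0) => [fx0|fx0].
  right; exists (fun x => if x == x0 then 1 else 0); split.
  - by move=> x; case: ifP.
  - by exists x0; rewrite ?mem_head ?eqxx.
  - by rewrite relU fx0 scaler0 add0r big1// => x _; rewrite scale0r.
have [tau tau0 Htau] := small_perturbation (fun x => (f x *m (f x0)^T) 0 0) Hh.
left; exists (h + tau *: (f x0)^T) => x; rewrite inE => xs.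
rewrite -[tau]opprK scaleNr mulmxBr -scalemxAr entryB mulNr opprK.
case/orP: xs => [/eqP->|/Htau//]; rewrite -/(l x0) lx0 add0r mulr_gt0//.
have [j fj] : exists j, f x0 0 j != 0.
  apply/existsP; apply: contra_neqT fx0 => /existsPn H.
  by apply/rowP => j; rewrite mxE; apply/eqP/negPn.
rewrite mxE (bigD1 j)//= mxE ltr_pwDl//.
  by rewrite -expr2 exprn_even_gt0.
by apply: sumr_ge0 => k _; rewrite mxE -expr2 sqr_ge0.
Qed.

Definition binom_sum (n D : nat) : nat := \sum_(k < D.+1) 'C(n, k).

Lemma binom_sumS n D : binom_sum n.+1 D.+1 = (binom_sum n D.+1 + binom_sum n D)%N.
Proof.
rewrite /binom_sum [in LHS]big_ord_recl bin0.
under eq_bigr do rewrite lift0 binS.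
rewrite big_split /= addnA; congr (_ + _)%N.
by rewrite [in RHS]big_ord_recl bin0.
Qed.

Lemma binom_sum_gt0 n D : (0 < binom_sum n D)%N.
Proof. by rewrite /binom_sum big_ord_recl bin0. Qed.

Lemma leq_binom_sum n D E : (D <= E)%N -> (binom_sum n D <= binom_sum n E)%N.
Proof.
move=> DE; rewrite /binom_sum -!(big_mkord xpredT (fun k => 'C(n, k))).
rewrite [X in (_ <= X)%N](big_cat_nat (n := D.+1))//=.
exact: leq_addr.
Qed.

Definition realizable (R : realFieldType) D (U : 'M[R]_D) n
    (h : n.-tuple 'cV[R]_D) (x : n.-tuple bool) : Prop :=
  exists2 p : 'rV[R]_D, (p <= U)%MS &
    forall k : 'I_n, 0 < (-1) ^+ (tnth x k) * (p *m tnth h k) 0 0.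

(** Inclusion-exclusion for the two ways of extending a pattern by one bit: the
    recursion behind the bound on sign patterns. *)
Lemma card_tuple_cons n (X : {set n.+1.-tuple bool}) :
  #|X| = (#|[set x : n.-tuple bool | [tuple of false :: x] \in X] :|:
           [set x : n.-tuple bool | [tuple of true :: x] \in X]| +
          #|[set x : n.-tuple bool | [tuple of false :: x] \in X] :&:
           [set x : n.-tuple bool | [tuple of true :: x] \in X]|)%N.
Proof.
rewrite cardsUI.
pose c (b : bool) (x : n.-tuple bool) := [tuple of b :: x].
have cinj b : injective (c b).
  by move=> x y /(congr1 val) /= [] /val_inj.
pose A := [set c false x | x in [set x | c false x \in X]].
pose B := [set c true x | x in [set x | c true x \in X]].
have XE : X = A :|: B.
  apply/setP => x; rewrite inE; apply/idP/orP => [|[]].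
  - case/tupleP: x => -[] x xX; [right|left]; apply/imsetP; exists x => //;
    by rewrite inE.
  - by case/imsetP => y; rewrite inE => yX ->.
  - by case/imsetP => y; rewrite inE => yX ->.
have AB : [disjoint A & B].
  rewrite -setI_eq0; apply/eqP/setP => x; rewrite !inE.
  apply/negP => /andP[/imsetP[y _ ->]] /imsetP[z _] /(congr1 val) /=.
  by [].
by rewrite [in LHS]XE cardsU disjoint_setI0// cards0 subn0 !card_imset.
Qed.

(** Cover's count. A pattern on the last [n] coordinates that extends by both signs
    of the first functional is realized on the kernel of this functional, whose
    intersection with [U] has smaller dimension; hence the recursion of
    [binom_sum]. *)
Lemma card_realizable (R : realFieldType) D n (U : 'M[R]_D)
    (h : n.-tuple 'cV[R]_D) :
  (#|[set x | `[< realizable U h x >]]| <= binom_sum n (\rank U))%N.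
Proof.
elim: n U h => [|n IHn] U h.
  apply: leq_trans (binom_sum_gt0 _ _).
  by rewrite (leq_trans (max_card _))// card_tuple expn0.
case/tupleP: h => h0 h.
have [Uh0|/eqP Uh0] := eqVneq (U *m h0) 0.
  rewrite (_ : [set x | _] = finset.set0) ?cards0//.
  apply/setP => x; rewrite !inE; apply/asboolP => -[p /submxP[q ->]] /(_ ord0).
  by rewrite tnth0 -mulmxA Uh0 mulmx0 mxE mulr0 ltxx.
rewrite card_tuple_cons.
pose ext b := [set x : n.-tuple bool | [tuple of b :: x] \in
  [set x | `[< realizable U [tuple of h0 :: h] x >]]].
set A := ext false; set B := ext true.
pose W : 'M[R]_D := (U :&: kermx h0)%MS.
have WU : (\rank W < \rank U)%N.
  rewrite ltnNge; apply: contra_notN Uh0 => UW.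
  have WsU : (W <= U)%MS by rewrite capmxSl.
  have /sub_kermxP : (U <= kermx h0)%MS.
    apply: submx_trans (capmxSr U _).
    by rewrite -/W -(geq_leqif (mxrank_leqif_sup WsU)).
  by [].
have AU : A :|: B \subset [set x | `[< realizable U h x >]].
  apply/fintype.subsetP => x; rewrite /A /B /ext !inE => /orP[] /asboolP[p pU Hp];
  by exists p => // k; have := Hp (lift ord0 k); rewrite !tnthS.
have AI : A :&: B \subset [set x | `[< realizable W h x >]].
  apply/fintype.subsetP => x; rewrite /A /B /ext !inE => /andP[/asboolP[p pU Hp] /asboolP[q qU Hq]].
  have := Hp ord0; have := Hq ord0; rewrite !tnth0 expr0 expr1 mul1r.
  set lp := (p *m h0) 0 0; set lq := (q *m h0) 0 0 => lq0 lp0.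
  have lq1 : 0 < - lq by rewrite -mulN1r.
  exists (- lq *: p + lp *: q).
    rewrite sub_capmx addmx_sub ?scalemx_sub//=.
    apply/sub_kermxP/matrixP => i j; rewrite !ord1 mulmxDl -!scalemxAl entryD.
    by rewrite -/lp -/lq mulNr mulrC addNr mxE.
  move=> k; have := Hp (lift ord0 k); have := Hq (lift ord0 k).
  rewrite !tnthS mulmxDl -!scalemxAl entryD.
  move=> h1 h2; rewrite mulrDr !(mulrCA (_ ^+ _)).
  by rewrite addr_gt0// mulr_gt0.
case rU : (\rank U) WU => [//|r]; rewrite ltnS => Wr.
rewrite binom_sumS leq_add//.
  by rewrite -rU; apply: leq_trans (subset_leq_card AU) (IHn _ _).
apply: leq_trans (subset_leq_card AI) (leq_trans (IHn _ _) _).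
exact: leq_binom_sum.
Qed.

(** The bound on sign patterns, in a form that needs no linear map in advance. The
    vectors [p x] are only known to satisfy no relation with coefficients of the
    same sign as bit [k]; the functionals whose signs give the bits are then
    supplied by [gordan]. *)
Lemma sign_pattern_bound (R : realFieldType) D n (X : {set n.-tuple bool})
    (p : n.-tuple bool -> 'rV[R]_D) :
  (forall (k : 'I_n) (g : n.-tuple bool -> R), (forall x, 0 <= g x) ->
     (exists2 x, x \in X & 0 < g x) ->
     \sum_(x in X) (g x * (-1) ^+ (tnth x k)) *: p x = 0 -> False) ->
  (#|X| <= binom_sum n D)%N.
Proof.
move=> noalign.
have /choice[h Hh] : forall k : 'I_n, exists h : 'cV[R]_D,
    forall x, x \in X -> 0 < (-1) ^+ (tnth x k) * (p x *m h) 0 0.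
  move=> k.
  have [[h Hh]|[g [g0 [x xX gx] gr]]] :=
    gordan (fun x : n.-tuple bool => (-1) ^+ (tnth x k) *: p x) (enum_uniq X).
    exists h => x xX; have := Hh x; rewrite mem_enum => /(_ xX).
    by rewrite -scalemxAl mxE.
  exfalso; apply: (noalign k g g0).
    by exists x => //; rewrite -mem_enum.
  rewrite -[RHS]gr big_enum/=; apply: eq_bigr => y _.
  by rewrite scalerA.
have Xr : X \subset [set x | `[< realizable 1%:M [tuple h k | k < n] x >]].
  apply/fintype.subsetP => x xX; rewrite inE; apply/asboolP; exists (p x).
    exact: submx1.
  by move=> k; rewrite tnth_mktuple; apply: Hh.
by have := leq_trans (subset_leq_card Xr) (card_realizable _ _); rewrite mxrank1.
Qed.

(** * Solving the equation in a strip *)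

Definition solves (R : realFieldType) (q : nat -> nat -> R) (a b : nat)
    (F : nat -> nat -> R) : Prop :=
  forall i j, (i.+2 <= a)%N -> (j.+2 <= b)%N ->
    F i.+2 j.+2 + F i j + F i.+2 j + F i j.+2 = q i.+1 j.+1 * F i.+1 j.+1.

(** The sites of a rotated rectangle are the pairs [(i, j)] with [i + j] even; the
    equation never mixes them with the others, where solutions are set to 0. *)
Definition even_supported (R : realFieldType) (F : nat -> nat -> R) : Prop :=
  forall i j, odd (i + j) -> F i j = 0.

Lemma solve_corner (R : realFieldType) (x y z w q p e B X : R) :
  `|x + y + z + w - q * p| <= e -> `|q| <= B -> `|p| <= X -> `|z| <= X ->
  `|w| <= X -> e <= X -> `|x| <= `|y| + (B + 3) * X.
Proof.
move=> He Hq Hp Hz Hw eX.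
have -> : x = (x + y + z + w - q * p) - y - z - w + q * p by ring.
have Hqp : `|q * p| <= B * X by rewrite normrM ler_pM.
apply: le_trans (ler_normD _ _) _; apply: le_trans (lerD (ler_normB _ _) (lexx _)) _.
have := ler_normB (x + y + z + w - q * p - y) z.
have := ler_normB (x + y + z + w - q * p) y.
lra.
Qed.

(** A priori bound for the equation without its centres on row [t]. The data are
    rows 0 and 1, one value in each further row, and row [T]. Rows up to [t] are
    bounded one after the other. Between rows [t] and [T] the
    roles of [i] and [j] are exchanged: columns are solved one after the other,
    which needs the boundary values on rows [t] and [T] only. A single
    boundary suffices in each column because [T - t] is odd. *)
Lemma row_to_strip_bound (R : realFieldType) (q H : nat -> nat -> R)
    (a T t : nat) (B G eta : R) :
  (0 < t)%N -> (t < T)%N -> odd (T - t) -> 0 <= eta -> 0 <= B ->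
  1 + (a + T)%:R * (B + 3) <= G ->
  even_supported H ->
  (forall i j, (i.+2 <= a)%N -> (j.+2 <= T)%N -> j.+1 != t -> ~~ odd (i + j) ->
     `|q i.+1 j.+1| <= B) ->
  (forall i, (i <= a)%N -> `|H i 0%N| <= eta /\ `|H i 1%N| <= eta) ->
  (forall j, (2 <= j < T)%N -> H 0%N j = 0 /\ H 1%N j = 0) ->
  (forall i, (i <= a)%N -> `|H i T| <= eta) ->
  (forall i j, (i.+2 <= a)%N -> (j.+2 <= T)%N -> j.+1 != t -> ~~ odd (i + j) ->
     `|H i.+2 j.+2 + H i j + H i.+2 j + H i j.+2 - q i.+1 j.+1 * H i.+1 j.+1|
       <= eta) ->
  forall i j, (i <= a)%N -> (j <= T)%N -> `|H i j| <= eta * G ^+ (T + a).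
Proof.
move=> t0 tT oTt eta0 B0 G1 Hev qB H01 Hcol HT Hres.
have B3 : 0 < B + 3 by lra.
have aT0 : 0 <= (a + T)%:R * (B + 3) by rewrite mulr_ge0// ltW.
have G1' : 1 <= G by lra.
have expG k l : (k <= l)%N -> eta * G ^+ k <= eta * G ^+ l.
  by move=> kl; rewrite ler_wpM2l// ler_weXn2l.
have etaG k : eta <= eta * G ^+ k by have := expG 0%N k (leq0n _); rewrite expr0 mulr1.
have stepG X (m : nat) : 0 <= X -> (m <= a + T)%N ->
    X + m%:R * ((B + 3) * X) <= X * G.
  move=> X0 mT; rewrite mulrA -{1}[X]mul1r -mulrDl mulrC ler_wpM2l//.
  by apply: le_trans G1; rewrite lerD2l ler_wpM2r ?(ltW B3)// ler_nat.
have rows : forall j, (j <= t)%N -> forall i, (i <= a)%N -> `|H i j| <= eta * G ^+ j.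
  elim/ltn_ind => -[|[|j]] IHj jt i ia.
  - by rewrite expr0 mulr1; have [] := H01 i ia.
  - by have [_ h] := H01 i ia; apply: le_trans h (etaG _).
  pose X := eta * G ^+ j.+1.
  have X0 : 0 <= X by apply: le_trans eta0 (etaG _).
  have claim : forall k, (k.+1 <= a)%N ->
      `|H k j.+2| <= k%:R * ((B + 3) * X) /\ `|H k.+1 j.+2| <= k%:R * ((B + 3) * X).
    have [h0 h1] : H 0%N j.+2 = 0 /\ H 1%N j.+2 = 0 by apply: Hcol; nat_lia.
    elim=> [|k IHk] ka; first by rewrite h0 h1 normr0 mul0r.
    have [IHk1 IHk2] := IHk (ltnW ka).
    have mono : k%:R * ((B + 3) * X) <= k.+1%:R * ((B + 3) * X).
      by rewrite ler_wpM2r ?ler_nat// mulr_ge0// ltW.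
    split; first exact: le_trans IHk2 mono.
    have [ood|e] := boolP (odd (k + j)).
      rewrite Hev ?normr0; last by rewrite !addSn !addnS /= !negbK.
      by rewrite mulr_ge0// mulr_ge0// ltW.
    have jT : (j.+2 <= T)%N by nat_lia.
    have jt' : j.+1 != t by nat_lia.
    have Hl l m : (l <= a)%N -> (m < j.+2)%N -> `|H l m| <= X.
      move=> la mj; apply: le_trans (IHj m mj _ l la) _; first by nat_lia.
      by apply: expG; nat_lia.
    have := @solve_corner _ (H k.+2 j.+2) (H k j.+2) (H k j) (H k.+2 j)
       (q k.+1 j.+1) (H k.+1 j.+1) eta B X.
    move=> /(_ _ (qB _ _ ka jT jt' e)) h.
    apply: le_trans (h _ _ _ _ (etaG _)) _ => //.
    - have -> : H k.+2 j.+2 + H k j.+2 + H k j + H k.+2 j =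
                H k.+2 j.+2 + H k j + H k.+2 j + H k j.+2 by ring.
      exact: Hres.
    - by apply: Hl; nat_lia.
    - by apply: Hl; nat_lia.
    - by apply: Hl; nat_lia.
    by rewrite -[k.+1%:R]natr1 [(_ + 1) * _]mulrDl mul1r lerD2r.
  have -> : eta * G ^+ j.+2 = X * G by rewrite exprSr mulrA.
  apply: le_trans (stepG X a X0 (leq_addr _ _)).
  rewrite -[X in X <= _]add0r lerD//.
  case: i ia => [|i] ia.
    case: (Hcol j.+2) => [|-> _]; first by nat_lia.
    by rewrite normr0 mulr_ge0// mulr_ge0// ltW.
  have [_ h] := claim i ia; apply: le_trans h _.
  by rewrite ler_wpM2r ?ler_nat ?(ltnW ia)// mulr_ge0// ltW.
have strip : forall i, (i.+1 <= a)%N -> forall j, (t <= j <= T)%N ->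
    `|H i j| <= eta * G ^+ (T + i) /\ `|H i.+1 j| <= eta * G ^+ (T + i.+1).
  have bdry i j : (i <= 1)%N -> (i <= a)%N -> (t <= j <= T)%N -> `|H i j| <= eta * G ^+ (T + i).
    move=> i1 ia /andP[]; rewrite leq_eqVlt => /orP[/eqP<- _|tj].
      by apply: le_trans (rows t (leqnn _) i ia) _; apply: expG; nat_lia.
    rewrite leq_eqVlt => /orP[/eqP->|jT].
      exact: le_trans (HT i ia) (etaG _).
    case: (Hcol j) => [|h0 h1]; first by nat_lia.
    have -> : H i j = 0 by case: i i1 {ia} => [|[|]].
    by rewrite normr0 (le_trans eta0 (etaG _)).
  elim=> [|i IHi] ia j jT.
    by split; apply: bdry => //; nat_lia.
  have [_ h1] := IHi (ltnW ia) j jT; split => //.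
  pose X := eta * G ^+ (T + i.+1).
  have X0 : 0 <= X by apply: le_trans eta0 (etaG _).
  have -> : eta * G ^+ (T + i.+2) = X * G by rewrite addnS exprSr mulrA.
  have col k l : (i <= k <= i.+1)%N -> (t <= l <= T)%N -> `|H k l| <= X.
    move=> ki lT; have [c0 c1] := IHi (ltnW ia) l lT.
    have [->|->] : k = i \/ k = i.+1 by nat_lia.
      by apply: le_trans c0 _; apply: expG; nat_lia.
    exact: c1.
  have [ood|e] := boolP (odd (i + j)).
    rewrite Hev ?normr0; first by rewrite mulr_ge0//; lra.
    by rewrite !addSn /= negbK.
  suff : `|H i.+2 j| <= X + (a + T)%:R * ((B + 3) * X).
    by move=> h; apply: le_trans h (stepG _ _ X0 (leqnn _)).
  have B3X : 0 <= (B + 3) * X by rewrite mulr_ge0// ltW.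
  (* as [T - t] is odd, exactly one of the rows [t] and [T] has a site in column
     [i + 2]; the column is solved starting from it *)
  have [ooT|eT] := boolP (odd (i + T)).
        have up : forall d, (t + d.*2 <= T)%N ->
        `|H i.+2 (t + d.*2)%N| <= X + d%:R * ((B + 3) * X).
      elim=> [|d IHd] dT.
        rewrite addn0 mul0r addr0; apply: le_trans (rows t (leqnn _) _ ia) _.
        by apply: expG; nat_lia.
      set l := (t + d.*2)%N in IHd *.
      have -> : (t + d.+1.*2)%N = l.+2 by rewrite /l; nat_lia.
      have lT : (l.+2 <= T)%N by rewrite /l; nat_lia.
      have e' : ~~ odd (i + l) by rewrite /l; nat_lia.
      have lt : l.+1 != t by rewrite /l; nat_lia.
      have := @solve_corner _ (H i.+2 l.+2) (H i.+2 l) (H i l) (H i l.+2)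
         (q i.+1 l.+1) (H i.+1 l.+1) eta B X.
      move=> /(_ _ (qB _ _ ia lT lt e')) h.
      apply: le_trans (h _ _ _ _ (etaG _)) _ => //.
      - have -> : H i.+2 l.+2 + H i.+2 l + H i l + H i l.+2 =
                  H i.+2 l.+2 + H i l + H i.+2 l + H i l.+2 by ring.
        exact: Hres.
      - by apply: col; rewrite /l; nat_lia.
      - by apply: col; rewrite /l; nat_lia.
      - by apply: col; rewrite /l; nat_lia.
      rewrite -[d.+1%:R]natr1 [(_ + 1) * _]mulrDl mul1r [X + _]addrA lerD2r.
      by apply: IHd; nat_lia.
    have jE : j = (t + ((j - t)./2).*2)%N by nat_lia.
    rewrite {1}jE; apply: le_trans (up _ _) _; first by nat_lia.
    by rewrite lerD2l ler_wpM2r// ler_nat; nat_lia.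
  have down : forall d, (t + d.*2 <= T)%N ->
      `|H i.+2 (T - d.*2)%N| <= X + d%:R * ((B + 3) * X).
    elim=> [|d IHd] dT.
      by rewrite subn0 mul0r addr0; apply: le_trans (HT _ ia) (etaG _).
    set l := (T - d.+1.*2)%N.
    have lE : (T - d.*2)%N = l.+2 by rewrite /l; nat_lia.
    rewrite lE in IHd.
    have lT : (l.+2 <= T)%N by rewrite /l; nat_lia.
    have e' : ~~ odd (i + l) by rewrite /l; nat_lia.
    have lt : l.+1 != t by rewrite /l; nat_lia.
    have := @solve_corner _ (H i.+2 l) (H i.+2 l.+2) (H i l) (H i l.+2)
       (q i.+1 l.+1) (H i.+1 l.+1) eta B X.
    move=> /(_ _ (qB _ _ ia lT lt e')) h.
    apply: le_trans (h _ _ _ _ (etaG _)) _ => //.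
    - have -> : H i.+2 l + H i.+2 l.+2 + H i l + H i l.+2 =
                H i.+2 l.+2 + H i l + H i.+2 l + H i l.+2 by ring.
      exact: Hres.
    - by apply: col; rewrite /l; nat_lia.
    - by apply: col; rewrite /l; nat_lia.
    - by apply: col; rewrite /l; nat_lia.
    rewrite -[d.+1%:R]natr1 [(_ + 1) * _]mulrDl mul1r [X + _]addrA lerD2r.
    by apply: IHd; nat_lia.
  have jE : j = (T - ((T - j)./2).*2)%N by nat_lia.
  rewrite {1}jE; apply: le_trans (down _ _) _; first by nat_lia.
  by rewrite lerD2l ler_wpM2r// ler_nat; nat_lia.
move=> i j ia jT; case: (leqP j t) => jt.
  by apply: le_trans (rows j jt i ia) (expG _ _ _); nat_lia.
have jj : (t <= j <= T)%N by nat_lia.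
case: i ia => [|i] ia.
  case: (posnP a) => [a0|apos].
    have [->|jT'] := eqVneq j T; first exact: le_trans (HT _ ia) (etaG _).
    case: (Hcol j) => [|-> _]; first by nat_lia.
    by rewrite normr0 (le_trans eta0 (etaG _)).
  have [h _] := strip 0%N apos j jj; apply: le_trans h (expG _ _ _); nat_lia.
by have [_ h] := strip i ia j jj; apply: le_trans h (expG _ _ _); nat_lia.
Qed.

(** * Counting the potentials on a row *)

(** The interior sites of row [t], whose parity is that of [t]. *)
Definition row_pos (t k : nat) : nat := (k.*2.+1 + ~~ odd t)%N.

(** A normalized solution that is tiny on rows 0 and 1 and on row [T] off [Zc], but
    alternates on row [t]: the sign [(-1) ^+ i./2] flips between consecutive sites
    of the row. *)
Definition exceptional (R : realFieldType) (v : nat -> nat -> R)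
    (lambda0 delta eta Lam : R) (a t T : nat) (Zc : {set 'I_a.+1}) : Prop :=
  exists lambda F,
    [/\ `|lambda - lambda0| <= delta, even_supported F,
        solves (fun i j => 4 + v i j - lambda) a T F &
        forall i j, (i <= a)%N -> (j <= T)%N -> `|F i j| <= Lam] /\
    [/\ forall i, (i <= a)%N -> `|F i 0%N| <= eta /\ `|F i 1%N| <= eta,
        forall i : 'I_a.+1, i \notin Zc -> `|F i T| <= eta &
        forall i, (i <= a)%N -> ~~ odd (i + t) -> 2^-1 <= (-1) ^+ i./2 * F i t].

Lemma norm_wsum (R : realFieldType) (I : finType) (X : {set I}) (w f : I -> R) e :
  (forall x, x \in X -> `|f x| <= e) ->
  `|\sum_(x in X) w x * f x| <= e * \sum_(x in X) `|w x|.
Proof.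
move=> fe; apply: le_trans (ler_norm_sum _ _ _) _.
rewrite mulr_sumr; apply: ler_sum => x xX.
by rewrite normrM mulrC ler_wpM2r// fe.
Qed.

(** The central counting estimate. For every configuration [x] of row [t], the
    parameters of its solution [F x] are the first entries of the rows and the
    entries of row [T] in [Zc]. If nonnegative weights, twisted by the signs given
    by bit [k], combined these parameters to 0, then by
    [row_to_strip_bound] the combination [H] of the solutions would be tiny. But
    [gH], a combination of the values of [H] around site [k] of row [t], equals
    the combination of the [(v - Vbar / 2) * F x], in which all terms
    have the same sign and size at least of order 1. So [sign_pattern_bound]
    applies. The solutions may belong to different energies, since the window
    [delta] is so small that this only contributes to the errors. *)
Lemma card_exceptional (R : realFieldType) (v0 : nat -> nat -> R)
    (lambda0 delta eta Lam Vbar B G : R) (a t T n : nat) (Zc : {set 'I_a.+1})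
    (X : {set n.-tuple bool}) :
  (0 < t)%N -> (t < T)%N -> odd (T - t) -> (n.*2 < a)%N ->
  0 <= delta <= 2^-1 -> delta * Lam <= eta -> 2 <= Vbar -> 0 <= B ->
  1 + (a + T)%:R * (B + 4) <= G -> eta * G ^+ (T + a).+1 < 4^-1 ->
  `|4 - lambda0 + Vbar / 2| <= B ->
  (forall i j, (0 < i < a)%N -> (0 < j < T)%N -> j != t -> ~~ odd (i + j) ->
     `|4 + v0 i j - lambda0| <= B) ->
  (forall x, x \in X -> exists v,
     [/\ forall k : 'I_n, v (row_pos t k) t = if tnth x k then Vbar else 0,
         forall i j, (0 < i < a)%N -> (0 < j < T)%N -> j != t -> ~~ odd (i + j) ->
           v i j = v0 i j &
         exceptional v lambda0 delta eta Lam t T Zc]) ->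
  (#|X| <= binom_sum n (T + #|Zc|))%N.
Proof.
move=> t0 tT oTt na /andP[delta0 delta1] dL V2 B0 G1 etaG Bl Bv hX.
have {hX}/choice[d Hd] : forall x : n.-tuple bool, exists d : R * (nat -> nat -> R),
    x \in X -> exists v,
     [/\ forall k : 'I_n, v (row_pos t k) t = if tnth x k then Vbar else 0,
         forall i j, (0 < i < a)%N -> (0 < j < T)%N -> j != t -> ~~ odd (i + j) ->
           v i j = v0 i j &
     [/\ `|d.1 - lambda0| <= delta, even_supported d.2,
        solves (fun i j => 4 + v i j - d.1) a T d.2 &
        forall i j, (i <= a)%N -> (j <= T)%N -> `|d.2 i j| <= Lam] /\
    [/\ forall i, (i <= a)%N -> `|d.2 i 0%N| <= eta /\ `|d.2 i 1%N| <= eta,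
        forall i : 'I_a.+1, i \notin Zc -> `|d.2 i T| <= eta &
        forall i, (i <= a)%N -> ~~ odd (i + t) -> 2^-1 <= (-1) ^+ i./2 * d.2 i t]].
  move=> x; have [xX|xX] := boolP (x \in X); last by exists (0, fun _ _ => 0).
  have [v [h1 h2 [lam [F h3]]]] := hX x xX.
  by exists (lam, F) => _; exists v.
pose F x := (d x).2.
pose p x : 'rV[R]_(T + #|Zc|) := \row_k
  match fintype.split (k : 'I_(T + #|Zc|)) with
  | inl j => F x 0%N j + F x 1%N j
  | inr m => F x (enum_val m : 'I_a.+1) T
  end.
apply: (@sign_pattern_bound R _ n X p) => k g g0 [x0 x0X gx0] rel.
pose w x := g x * (-1) ^+ (tnth x k).
have wE x : `|w x| = g x by rewrite normrM normrX normrN1 expr1n mulr1 ger0_norm.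
pose H i j := \sum_(x in X) w x * F x i j.
pose S := \sum_(x in X) `|w x|.
have S0 : 0 < S.
  rewrite /S (bigD1 x0)//= ltr_pwDl ?wE//.
  by apply: sumr_ge0 => *; rewrite wE.
have rel' m : \sum_(x in X) w x * p x 0 m = 0.
  have := congr1 (fun M : 'rV[R]_(T + #|Zc|) => M 0 m) rel.
  rewrite summxE [RHS]mxE => relm; rewrite -[RHS]relm.
  by apply: eq_bigr => x _; rewrite [RHS]mxE.
pose q i j := 4 + v0 i j - lambda0.
have eta0 : 0 <= eta.
  apply: le_trans dL; rewrite mulr_ge0//.
  have [v [_ _ [[_ _ _ /(_ 0%N 0%N)]]]] := Hd x0 x0X.
  by move=> /(_ isT isT) h _; apply: le_trans h.
have Hev : even_supported H.
  move=> i j ij; rewrite /H big1// => x xX.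
  have [v [_ _ [[_ /(_ i j ij) Fev _ _] _]]] := Hd x xX.
  by rewrite /F Fev mulr0.
have aprio : forall i j, (i <= a)%N -> (j <= T)%N ->
    `|H i j| <= (eta * S) * G ^+ (T + a).
  apply: (@row_to_strip_bound _ q H a T t B G) => //.
  - by rewrite mulr_ge0// ltW.
  - by apply: le_trans G1; rewrite lerD2l ler_wpM2l// lerD2l ler_nat.
  - move=> i j ia jT jt ij; apply: Bv => //.
    by rewrite addSn addnS /= negbK.
  - move=> i ia; split; apply: norm_wsum => x xX;
      have [v [_ _ [_ [/(_ i ia)[h0 h1] _ _]]]] := Hd x xX => //.
  - move=> j /andP[j2 jT].
    have := rel' (lshift _ (Ordinal jT)).
    under eq_bigr do rewrite mxE (unsplitK (inl (Ordinal jT))) /= mulrDr.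
    rewrite big_split /= -/(H 0%N j) -/(H 1%N j).
    have [ood|e] := boolP (odd j).
      by rewrite (Hev 0%N j)// add0r.
    by rewrite (Hev 1%N j) ?add1n//= addr0.
  - move=> i ia; pose i' : 'I_a.+1 := Ordinal (ia : (i < a.+1)%N).
    have [iZ|iZ] := boolP (i' \in Zc).
      suff -> : H i T = 0 by rewrite normr0 mulr_ge0// ltW.
      have := rel' (rshift _ (enum_rank_in iZ i')).
      by under eq_bigr do rewrite mxE (unsplitK (inr (enum_rank_in iZ i'))) enum_rankK_in//.
    apply: norm_wsum => x xX.
    by have [v [_ _ [_ [_ /(_ i' iZ) h _]]]] := Hd x xX.
  - move=> i j ia jT jt ij.
    have -> : H i.+2 j.+2 + H i j + H i.+2 j + H i j.+2 - q i.+1 j.+1 * H i.+1 j.+1 =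
        \sum_(x in X) w x * (((d x).1 - lambda0) * - F x i.+1 j.+1).
      rewrite /H mulr_sumr -!big_split -sumrB /=; apply: eq_bigr => x xX.
      have [v [_ vv0 [[_ _ /(_ i j ia jT) sol _] _]]] := Hd x xX.
      have -> : w x * F x i.+2 j.+2 + w x * F x i j + w x * F x i.+2 j + w x * F x i j.+2
          = w x * (F x i.+2 j.+2 + F x i j + F x i.+2 j + F x i j.+2) by ring.
      rewrite sol -/(F x) vv0//; first by rewrite /q; ring.
      by rewrite addSn addnS /= negbK.
    apply: norm_wsum => x xX.
    have [v [_ _ [[dl _ _ Lm] _]]] := Hd x xX.
    rewrite normrM normrN; apply: le_trans dL; apply: ler_pM => //.
    by apply: Lm; exact: ltnW.
have [s sE] : exists s, row_pos t k = s.+1.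
  by exists (k.*2 + ~~ odd t)%N; rewrite /row_pos addSn.
have tE : t = t.-1.+1 by rewrite prednK.
have sa : (s.+2 <= a)%N.
  by rewrite -sE /row_pos; have := ltn_ord k; nat_lia.
have ost : ~~ odd (s.+1 + t) by rewrite -sE /row_pos; nat_lia.
pose u := t.-1.
have ut : u.+1 = t by rewrite -tE.
have uT : (u.+2 <= T)%N by rewrite ut.
pose gH := H s.+2 u.+2 + H s u + H s.+2 u + H s u.+2
           - (4 - lambda0 + Vbar / 2) * H s.+1 t.
have gHle : `|gH| < S / 4.
  pose Y := (eta * S) * G ^+ (T + a).
  have Y0 : 0 <= Y by apply: le_trans (aprio 0%N 0%N isT isT).
  have HY i j : (i <= s.+2)%N -> (j <= u.+2)%N -> `|H i j| <= Y.
    by move=> i1 j1; apply: aprio; [exact: leq_trans i1 sa|exact: leq_trans j1 uT].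
  have hq : `|(4 - lambda0 + Vbar / 2) * H s.+1 t| <= B * Y.
    by rewrite normrM ler_pM// HY// ?ut// -ut.
  have le1 : `|gH| <= (B + 4) * Y.
    have n1 := HY s.+2 u.+2 (leqnn _) (leqnn _).
    have n2 := HY s u (ltnW (leqnSn _)) (ltnW (leqnSn _)).
    have n3 := HY s.+2 u (leqnn _) (ltnW (leqnSn _)).
    have n4 := HY s u.+2 (ltnW (leqnSn _)) (leqnn _).
    rewrite /gH; move: n1 n2 n3 n4 hq; rewrite !ler_norml.
    by move=> /andP[? ?] /andP[? ?] /andP[? ?] /andP[? ?] /andP[? ?]; apply/andP; split; lra.
  have le2 : (B + 4) * Y <= S * (eta * G ^+ (T + a).+1).
    have -> : S * (eta * G ^+ (T + a).+1) = G * Y by rewrite /Y exprS; ring.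
    rewrite ler_wpM2r//; apply: le_trans G1.
    have : 1 <= (a + T)%:R :> R by rewrite ler1n addn_gt0 (leq_ltn_trans _ tT)// orbT.
    have : 0 <= B + 4 by lra.
    by nra.
  apply: le_lt_trans le1 (le_lt_trans le2 _).
  by rewrite ltr_pM2l.
have gHge : S / 4 <= - ((-1) ^+ (s.+1)./2 * gH).
  have -> : gH = \sum_(x in X) w x * (((if tnth x k then Vbar else 0) - Vbar / 2
      + lambda0 - (d x).1) * F x s.+1 t).
    rewrite /gH /H mulr_sumr -!big_split -sumrB /=; apply: eq_bigr => x xX.
    have [v [vk _ [[_ _ /(_ s u sa uT) sol _] _]]] := Hd x xX.
    have -> : w x * F x s.+2 u.+2 + w x * F x s u + w x * F x s.+2 u + w x * F x s u.+2
        = w x * (F x s.+2 u.+2 + F x s u + F x s.+2 u + F x s u.+2) by ring.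
    by rewrite sol -/(F x) -(vk k) sE ut; ring.
  rewrite /S mulr_suml mulr_sumr -sumrN; apply: ler_sum => x xX.
  have [v [_ _ [[dl _ _ _] [_ _ /(_ s.+1 (ltnW sa) ost)]]]] := Hd x xX.
  rewrite -/(F x) wE /w; set f := F x s.+1 t; set e := _ ^+ (s.+1)./2 => ef.
  have -> : - (e * (g x * (-1) ^+ (tnth x k) * (((if tnth x k then Vbar else 0) - Vbar / 2
      + lambda0 - (d x).1) * f))) = g x * ((e * f) * - ((-1) ^+ (tnth x k)
       * ((if tnth x k then Vbar else 0) - Vbar / 2 + lambda0 - (d x).1))) by ring.
  rewrite ler_wpM2l//.
  have : 2^-1 <= - ((-1) ^+ (tnth x k)
       * ((if tnth x k then Vbar else 0) - Vbar / 2 + lambda0 - (d x).1)).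
    move: dl; rewrite ler_norml => /andP[? ?].
    by case: (tnth x k); rewrite ?expr0 ?expr1; lra.
  by move: ef; set A := e * f; set C := - _; nra.
have : - ((-1) ^+ (s.+1)./2 * gH) <= `|gH|.
  apply: le_trans (ler_norm _) _.
  by rewrite normrN normrM normrX normrN1 expr1n mul1r.
by move: gHle gHge; set A := - _; lra.
Qed.

(** * Growth along rows *)

Definition bad_in_row (R : realFieldType) (F : nat -> nat -> R) (M : R) (a j : nat) :
  {set 'I_a.+1} := [set i : 'I_a.+1 | M < `|F i j|].

Lemma alternating_row (R : realFieldType) (f : nat -> R) (a : nat) (e : R) :
  0 <= e ->
  (forall i, (i.+2 <= a)%N -> `|f i.+2 - f i| <= e) ->
  forall i d, (i + d.*2 <= a)%N -> `|f (i + d.*2)%N - f i| <= d%:R * e.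
Proof.
move=> e0 step i; elim=> [|d IHd] ida; first by rewrite addn0 subrr normr0 mul0r.
rewrite doubleS !addnS in ida *.
have h1 := step _ ida; have h2 := IHd (ltnW (ltnW ida)).
have := ler_normD (f (i + d.*2).+2 - f (i + d.*2)%N) (f (i + d.*2)%N - f i).
by rewrite addrA subrK -[d.+1%:R]natr1; lra.
Qed.

(** Let row [t] maximize the supremum of a row, discounted by [G ^- 2] per row.
    Earlier rows are then smaller than row [t], so row [t] alternates with
    almost constant modulus, and later rows are not much larger. If the bound
    fails somewhere, row [t] is huge compared to [M]: it is neither one of the
    first two rows nor one of the last two, which contain few large
    sites. Normalizing by the size of row [t] gives an exceptional solution. *)
Lemma bounded_or_exceptional (R : realFieldType) (v F : nat -> nat -> R)
    (lambda lambda0 delta M B G : R) (a T K : nat) :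
  (0 < a)%N -> (1 < T)%N -> (0 < K)%N -> 0 < M -> 0 <= B ->
  1 + (a + T)%:R * (B + 4) <= G ->
  `|lambda - lambda0| <= delta ->
  even_supported F -> solves (fun i j => 4 + v i j - lambda) a T.+1 F ->
  (forall i j, (0 < i < a)%N -> (0 < j <= T)%N -> ~~ odd (i + j) ->
     `|4 + v i j - lambda| <= B) ->
  (forall i, (i <= a)%N -> `|F i 0%N| <= M /\ `|F i 1%N| <= M) ->
  (#|bad_in_row F M a T| < a./2)%N -> (#|bad_in_row F M a T.+1| < a./2)%N ->
  (forall i j, (i <= a)%N -> (j <= T.+1)%N -> `|F i j| <= M * G ^+ (K + T.+1.*2)) \/
  exists t T' (Zc : {set 'I_a.+1}), [/\ (1 < t < T')%N, (T <= T' <= T.+1)%N, odd (T' - t),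
    (#|Zc| <= maxn #|bad_in_row F M a T| #|bad_in_row F M a T.+1|)%N &
    exceptional v lambda0 delta (G ^- K) (G ^+ T.+1.*2) t T' Zc].
Proof.
move=> a0 T1 K0 M0 B0 G1 lamd Fev sol qB F01 badT badT1.
have aT1 : 1 <= (a + T)%:R :> R by rewrite ler1n addn_gt0 a0.
have G5 : 5 <= G by nra.
have G1' : 1 <= G by lra.
have G0 : 0 < G by lra.
have Gk k : 0 < G ^+ k by rewrite exprn_gt0.
case: (pselect (exists i j, [/\ (i <= a)%N, (j <= T.+1)%N &
  M * G ^+ (K + T.+1.*2) < `|F i j|])); last first.
  move=> nex; left => i j ia jT; rewrite leNgt; apply/negP => lt.
  by apply: nex; exists i, j.
move=> [i0 [j0 [i0a j0T big0]]]; right.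
pose irow j : 'I_a.+1 := [arg max_(i > ord0) `|F i j|]%O.
pose m j : R := `|F (irow j) j|.
have mP i j : (i <= a)%N -> `|F i j| <= m j.
  move=> ia; rewrite /m /irow; case: Order.TotalTheory.arg_maxP => // k _ /(_ (Ordinal (ia : (i < a.+1)%N)) isT).
  by [].
have m0 j : 0 <= m j by rewrite /m.
(* the factor [2] in the exponent makes row [t] dominate all earlier rows by
   [G ^ 2], more than the factor that one application of the equation costs *)
pose t' : 'I_T.+2 := [arg max_(j > ord0) (m j / G ^+ (j.*2))]%O.
pose t : nat := t'.
have tT1 : (t <= T.+1)%N by rewrite -ltnS /t.
have dom0 j : (j <= T.+1)%N -> m j / G ^+ (j.*2) <= m t / G ^+ (t.*2).
  move=> jT; rewrite /t /t'; case: Order.TotalTheory.arg_maxP => // k _ /(_ (Ordinal (jT : (j < T.+2)%N)) isT).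
  by [].
have dom j : (j <= T.+1)%N -> m j * G ^+ (t.*2) <= m t * G ^+ (j.*2).
  by move=> /dom0; rewrite ler_pdivrMr// mulrAC ler_pdivlMr.
have mtbig : M * G ^+ K < m t.
  have h1 := dom j0 j0T; have h2 := mP i0 j0 i0a.
  have h3 : G ^+ (j0.*2) <= G ^+ (T.+1.*2) by rewrite ler_weXn2l// leq_double.
  have h4 : 1 <= G ^+ (t.*2) by rewrite exprn_ege1.
  have h5 : m t * G ^+ (j0.*2) <= m t * G ^+ (T.+1.*2) by rewrite ler_wpM2l.
  have h6 : m j0 <= m j0 * G ^+ (t.*2) by rewrite ler_peMr.
  rewrite exprD mulrA in big0.
  rewrite -(ltr_pM2r (Gk T.+1.*2)).
  by apply: lt_le_trans big0 _; lra.
have mt0 : 0 < m t by apply: lt_trans mtbig; rewrite mulr_gt0.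
have MK : M * 2 <= M * G ^+ K.
  rewrite ler_pM2l//; case: K K0 {mtbig big0} => // K _; rewrite exprS.
  have : 1 <= G ^+ K by rewrite exprn_ege1.
  by nra.
have t1 : (1 < t)%N.
  have mM j : (j <= 1)%N -> m j <= M.
    case: j => [|[|//]] _; rewrite /m.
      by have [] := F01 (irow 0%N) (leq_ord _).
    by have [] := F01 (irow 1%N) (leq_ord _).
  by case: (ltnP 1 t) => // /mM; lra.
pose f i : R := (-1) ^+ i./2 * F i t.
pose e := (B + 2) * (m t / G ^+ 2).
have e0 : 0 <= e by rewrite mulr_ge0 ?divr_ge0 ?(ltW mt0) ?(ltW (Gk _))//; lra.
have stepf : forall i, (i.+2 <= a)%N -> `|f i.+2 - f i| <= e.
  move=> i ia.
  have -> : f i.+2 - f i = - (-1) ^+ i./2 * (F i.+2 t + F i t).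
    by rewrite /f /= exprS; ring.
  rewrite normrM normrN normrX normrN1 expr1n mul1r.
  have [ood|ev] := boolP (odd (i + t)).
    by rewrite !Fev ?addr0 ?normr0// !addSn /= negbK.
  pose u := (t - 2)%N.
  have tu : t = u.+2 by rewrite /u; nat_lia.
  rewrite tu in dom tT1 ev *.
  have := sol i u ia tT1.
  have nb l : (l < u.+2)%N -> m l <= m u.+2 / G ^+ 2.
    move=> lu; rewrite ler_pdivlMr//.
    have h1 := dom l (leq_trans (ltnW lu) tT1).
    have h2 : G ^+ (l.*2) * G ^+ 2 <= G ^+ (u.+2.*2).
      by rewrite -exprD ler_weXn2l//; nat_lia.
    rewrite -(ler_pM2r (Gk l.*2)) -mulrA [G ^+ 2 * _]mulrC.
    apply: le_trans h1; exact: ler_wpM2l.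
  have n1 : `|F i.+1 u.+1| <= m u.+2 / G ^+ 2.
    by apply: le_trans (mP _ _ _) (nb _ _) => //; exact: ltnW.
  have n2 : `|F i u| <= m u.+2 / G ^+ 2.
    by apply: le_trans (mP _ _ _) (nb _ _) => //; exact: ltnW (ltnW _).
  have n3 : `|F i.+2 u| <= m u.+2 / G ^+ 2.
    by apply: le_trans (mP _ _ _) (nb _ _).
  have qb : `|4 + v i.+1 u.+1 - lambda| <= B.
    apply: qB => //; first by nat_lia.
  have n4 : `|(4 + v i.+1 u.+1 - lambda) * F i.+1 u.+1| <= B * (m u.+2 / G ^+ 2).
    by rewrite normrM ler_pM.
  move=> E.
  have -> : F i.+2 u.+2 + F i u.+2 = (4 + v i.+1 u.+1 - lambda) * F i.+1 u.+1
      - F i u - F i.+2 u by rewrite -E; ring.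
  rewrite /e tu; set z := _ * F i.+1 u.+1 in n4 *; set X := m _ / _ in n1 n2 n3 n4 *.
  by have := ler_normB (z - F i u) (F i.+2 u); have := ler_normB z (F i u); lra.
have ae : a%:R * e <= m t / 2.
  have -> : a%:R * e = (a%:R * (B + 2)) * (m t / G ^+ 2) by rewrite /e mulrA.
  have h1 : a%:R * (B + 2) <= G.
    apply: le_trans G1; rewrite natrD.
    have ha : 0 <= a%:R :> R by []. have hT : 0 <= T%:R :> R by [].
    by nra.
  apply: le_trans (_ : G * (m t / G ^+ 2) <= _).
    by rewrite ler_wpM2r// divr_ge0 ?(ltW mt0) ?(ltW (Gk _)).
  have -> : G * (m t / G ^+ 2) = m t / G by rewrite expr2; field; rewrite gt_eqF.
  by rewrite ler_pM2l// lef_pV2 ?posrE//; lra.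
pose i1 : nat := irow t.
have i1a : (i1 <= a)%N by rewrite /i1 leq_ord.
have fi1 : `|f i1| = m t.
  by rewrite /f normrM normrX normrN1 expr1n mul1r.
have ev1 : ~~ odd (i1 + t).
  apply/negP => ood; have := Fev _ _ ood => F0.
  by move: mt0; rewrite -fi1 /f F0 mulr0 normr0 ltxx.
pose s : R := Num.sg (f i1).
have s1 : `|s| = 1.
  by rewrite /s normr_sg; case: eqP => // h; move: mt0; rewrite -fi1 h normr0 ltxx.
have sf : s * f i1 = m t by rewrite /s -normrEsg.
have osc i : (i <= a)%N -> ~~ odd (i + t) -> m t / 2 <= s * f i.
  move=> ia ev.
  have close : `|f i - f i1| <= a%:R * e.
    have mon d : (d <= a)%N -> d%:R * e <= a%:R * e by move=> da; rewrite ler_wpM2r// ler_nat.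
    have [le|lt] := leqP i1 i.
      have -> : i = (i1 + ((i - i1)./2).*2)%N by nat_lia.
      apply: le_trans (alternating_row e0 stepf _) (mon _ _); nat_lia.
    rewrite distrC.
    have {1}-> : i1 = (i + ((i1 - i)./2).*2)%N by nat_lia.
    apply: le_trans (alternating_row e0 stepf _) (mon _ _); nat_lia.
  have : `|s * (f i - f i1)| <= m t / 2 by rewrite normrM s1 mul1r; lra.
  by rewrite mulrBr sf ler_norml => /andP[]; lra.
have rowbad : (a./2 <= #|bad_in_row F M a t|)%N.
  pose g (k : 'I_a./2) : 'I_a.+1 := inord (k.*2 + odd t).
  have gE k : g k = (k.*2 + odd t)%N :> nat.
    by rewrite inordK//; have := ltn_ord k; nat_lia.
  have ginj : injective g.
    move=> k l /(congr1 val) /=; rewrite !gE => h; apply/val_inj => /=; nat_lia.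
  rewrite -[X in (X <= _)%N]card_ord -(card_imset _ ginj).
  apply/subset_leq_card/fintype.subsetP => i /imsetP[k _ ->].
  rewrite inE gE.
  have h1 : (k.*2 + odd t <= a)%N by have := ltn_ord k; nat_lia.
  have h2 : ~~ odd (k.*2 + odd t + t) by nat_lia.
  have := osc _ h1 h2; have := ler_norm (s * f (k.*2 + odd t)%N).
  rewrite normrM s1 mul1r /f normrM normrX normrN1 expr1n mul1r.
  by lra.
have tT : (t < T)%N.
  have : t <> T by move=> tE; rewrite tE in rowbad; rewrite leqNgt badT in rowbad.
  have : t <> T.+1 by move=> tE; rewrite tE in rowbad; rewrite leqNgt badT1 in rowbad.
  by move: tT1; nat_lia.
(* the strip argument needs an odd distance, whence the two good rows *)
pose T' := if odd (T - t) then T else T.+1.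
have TT' : T' = T \/ T' = T.+1 by rewrite /T'; case: ifP; [left|right].
have oT' : odd (T' - t).
  rewrite /T'; case: ifP => // oo; rewrite subSn ?(ltnW tT)//=.
  by rewrite oo.
exists t, T', (bad_in_row F M a T'); split => //.
- by rewrite t1; case: TT' => ->; rewrite ?tT// ltnW.
- by case: TT' => ->; rewrite leqnn ?leqnSn.
- by case: TT' => ->; rewrite leq_max leqnn ?orbT.
have T'T : (T' <= T.+1)%N by case: TT' => ->.
exists lambda, (fun i j => (s / m t) * F i j).
have c1 x : `|s / m t * x| = `|x| / m t.
  by rewrite normrM normf_div s1 (gtr0_norm mt0) mul1r mulrC.
have smallM x : `|x| <= M -> `|s / m t * x| <= G ^- K.
  move=> xM; rewrite c1 ler_pdivrMr// mulrC ler_pdivlMr//.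
  apply: le_trans (ltW mtbig); rewrite ler_pM2r//.
split; split => //.
- by move=> i j ij; rewrite Fev// mulr0.
- move=> i j ia jT; have jT' : (j.+2 <= T.+1)%N by exact: leq_trans jT T'T.
  have := sol i j ia jT'; set q := 4 + _ - _ => E.
  have -> : q * (s / m t * F i.+1 j.+1) = s / m t * (q * F i.+1 j.+1) by ring.
  by rewrite -E; ring.
- move=> i j ia jT; have jT' : (j <= T.+1)%N by exact: leq_trans jT T'T.
  rewrite c1 ler_pdivrMr//; apply: le_trans (mP _ _ ia) _.
  have h1 := dom j jT'.
  have h2 : G ^+ j.*2 <= G ^+ T.+1.*2 by rewrite ler_weXn2l// leq_double.
  have h3 : 1 <= G ^+ t.*2 by rewrite exprn_ege1.
  have h4 : m j <= m j * G ^+ t.*2 by rewrite ler_peMr.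
  have h5 : m t * G ^+ j.*2 <= m t * G ^+ T.+1.*2 by rewrite ler_pM2l.
  by lra.
- by move=> i ia; have [h0 h1] := F01 i ia; split; exact: smallM.
- by move=> i; rewrite inE -leNgt; exact: smallM.
- move=> i ia ev; have := osc i ia ev; rewrite /f.
  have -> : (-1) ^+ i./2 * (s / m t * F i t) = (s * ((-1) ^+ i./2 * F i t)) / m t by ring.
  by rewrite ler_pdivlMr// mulrC.
Qed.

(** * Counting probability on finite configuration spaces *)

(** The uniform probability on configurations of fair bits. *)
Definition pr (R : realFieldType) (I : finType) (E : {set {ffun I -> bool}}) : R :=
  #|E|%:R / 2 ^+ #|I|.

Lemma card_bool_ffun (I : finType) : #|{ffun I -> bool}| = (2 ^ #|I|)%N.
Proof. by rewrite card_ffun card_bool. Qed.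

Lemma pr_ge0 (R : realFieldType) (I : finType) (E : {set {ffun I -> bool}}) :
  0 <= pr R E.
Proof. by rewrite /pr divr_ge0// exprn_ge0. Qed.

Lemma prU (R : realFieldType) (I : finType) (E F : {set {ffun I -> bool}}) :
  pr R (E :|: F) <= pr R E + pr R F.
Proof.
rewrite /pr -mulrDl ler_pM2r ?invr_gt0 ?exprn_gt0// -natrD ler_nat.
by rewrite cardsU leq_subr.
Qed.

Lemma prC (R : realFieldType) (I : finType) (E : {set {ffun I -> bool}}) :
  pr R (~: E) = 1 - pr R E.
Proof.
have h : (0 : R) < 2 ^+ #|I| by rewrite exprn_gt0.
have := cardsC E; rewrite card_bool_ffun => /(congr1 (fun n => n%:R : R)).
rewrite natrD natrX => cE; rewrite /pr.
have -> : #|~: E|%:R = 2 ^+ #|I| - #|E|%:R :> R by rewrite -cE addrC addKr.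
by rewrite mulrBl divff ?gt_eqF.
Qed.

Lemma pr_bigcup (R : realFieldType) (I J : finType) (P : pred J)
    (E : J -> {set {ffun I -> bool}}) (F : {set {ffun I -> bool}}) :
  (forall w, w \in F -> exists2 j, P j & w \in E j) ->
  pr R F <= \sum_(j | P j) pr R (E j).
Proof.
move=> sub; rewrite /pr -mulr_suml ler_pM2r ?invr_gt0 ?exprn_gt0//.
rewrite -natr_sum ler_nat.
have FE : F \subset \bigcup_(j | P j) E j.
  apply/fintype.subsetP => w /sub[j Pj wE]; apply/finset.bigcupP; by exists j.
apply: leq_trans (subset_leq_card FE) _.
elim/big_rec2: _ => [|j n A Pj AB]; first by rewrite cards0.
by rewrite cardsU (leq_trans (leq_subr _ _))// leq_add2l.
Qed.

Definition resample (I : finType) n (r : 'I_n -> I) (w : {ffun I -> bool})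
    (x : n.-tuple bool) : {ffun I -> bool} :=
  [ffun i => if [pick k | r k == i] is Some k then tnth x k else w i].

Lemma resample_row (I : finType) n (r : 'I_n -> I) w (x : n.-tuple bool) k :
  injective r -> resample r w x (r k) = tnth x k.
Proof.
move=> rinj; rewrite ffunE; case: pickP => [l /eqP/rinj-> //|/(_ k)].
by rewrite eqxx.
Qed.

Lemma resample_off (I : finType) n (r : 'I_n -> I) w (x : n.-tuple bool) i :
  (forall k, r k != i) -> resample r w x i = w i.
Proof.
move=> ri; rewrite ffunE; case: pickP => // k.
by rewrite (negbTE (ri k)).
Qed.

(** Resampling the bits on the range of [r] preserves the uniform measure, so a
    bound on the number of values of these bits that lead to [E], uniform in the
    other bits, bounds the probability of [E]. *)
Lemma pr_resample (R : realFieldType) (I : finType) n (r : 'I_n -> I)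
    (E : {set {ffun I -> bool}}) (S : nat) :
  injective r ->
  (forall w, (#|[set x : n.-tuple bool | resample r w x \in E]| <= S)%N) ->
  pr R E <= S%:R / 2 ^+ n.
Proof.
move=> rinj ES.
have p0 k : (0 : R) < 2 ^+ k by rewrite exprn_gt0.
rewrite /pr ler_pdivrMr// mulrAC ler_pdivlMr//.
rewrite -!natrX -!natrM ler_nat.
pose P := [set p : {ffun I -> bool} * n.-tuple bool | resample r p.1 p.2 \in E].
have PS : (#|P| <= S * 2 ^ #|I|)%N.
  rewrite mulnC -card_bool_ffun -sum_nat_const.
  have -> : #|P| = (\sum_w #|[set x : n.-tuple bool | resample r w x \in E]|)%N.
    under eq_bigr do rewrite -sum1_card.
    rewrite pair_big_dep -sum1_card /=; apply: eq_bigl => -[w x].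
    by rewrite !inE.
  by apply: leq_sum => w _.
apply: leq_trans PS.
pose f (p : {ffun I -> bool} * n.-tuple bool) :=
  (resample r p.1 p.2, [tuple p.1 (r k) | k < n]).
have fK : involutive f.
  case=> w x; rewrite /f /=; congr (_, _).
    apply/ffunP => i; case: (pickP (fun k => r k == i)) => [k /eqP<-|off].
      by rewrite resample_row// tnth_mktuple.
    by rewrite !resample_off// => k; rewrite off.
  by apply: eq_from_tnth => k; rewrite tnth_mktuple resample_row.
have -> : (2 ^ n)%N = #|[set: n.-tuple bool]| by rewrite cardsT card_tuple card_bool.
rewrite -cardsX -[X in (X <= _)%N](card_imset _ (inv_inj fK)).
apply/subset_leq_card/fintype.subsetP => q /imsetP [[w x]].
rewrite !inE /= andbT => wE ->.
have := fK (w, x); rewrite /f /= => -[-> _].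
exact: wE.
Qed.

Definition depends_on (I : finType) (S : {set I}) (E : {set {ffun I -> bool}}) :=
  forall w w' : {ffun I -> bool}, (forall i, i \in S -> w i = w' i) ->
  w \in E -> w' \in E.

(** Exchanging the coordinates in [S] between two configurations is an involution
    of the pairs; it maps those whose first component is in both events to those
    whose components are in [E] and [E'] respectively. *)
Lemma pr_indep (R : realFieldType) (I : finType) (S S' : {set I})
    (E E' : {set {ffun I -> bool}}) :
  depends_on S E -> depends_on S' E' -> [disjoint S & S'] ->
  pr R (E :&: E') <= pr R E * pr R E'.
Proof.
move=> SE SE' SS'.
have c0 : (0 : R) < 2 ^+ #|I| by rewrite exprn_gt0.
rewrite /pr mulrACA -invfM ler_pdivlMr ?mulr_gt0// mulrA divfK ?gt_eqF//.
rewrite -!natrX -!natrM ler_nat -card_bool_ffun -cardsT -!cardsX.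
pose mix (v w : {ffun I -> bool}) := [ffun i => if i \in S then v i else w i].
pose f (p : {ffun I -> bool} * {ffun I -> bool}) := (mix p.1 p.2, mix p.2 p.1).
have fK : involutive f.
  by case=> v w; rewrite /f /=; congr (_, _); apply/ffunP => i; rewrite !ffunE; case: (i \in S).
rewrite -[X in (X <= _)%N](card_imset _ (inv_inj fK)).
apply/subset_leq_card/fintype.subsetP => q /imsetP [[v w]].
rewrite !inE /= andbT => /andP[vE vE'] -> /=; apply/andP; split.
  by apply: SE vE => i iS; rewrite ffunE iS.
apply: SE' vE' => i iS'; rewrite ffunE; case: ifP => // iS.
by move: SS' => /pred0P/(_ i) /=; rewrite iS iS'.
Qed.

(** A union bound over the at most [2 ^ #|J|] sets of failing indices, each of which
    has a product probability by independence. *)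
Lemma pr_many_fail (R : realFieldType) (I J : finType) (S : J -> {set I})
    (E : J -> {set {ffun I -> bool}}) (p : R) :
  (forall j, depends_on (S j) (E j)) ->
  (forall j l, j != l -> [disjoint S j & S l]) ->
  0 <= p <= 1 -> (forall j, pr R (E j) <= p) ->
  pr R [set w | (#|J| <= 2 * #|[set j | w \in E j]|)%N] <=
    2 ^+ #|J| * p ^+ (#|J|./2).
Proof.
move=> SE dis /andP[p0 p1] Ep.
have inter (s : seq J) : uniq s -> pr R (\bigcap_(j <- s) E j) <= p ^+ size s.
  elim: s => [_|j s IHs /= /andP[js us]].
    rewrite big_nil expr0 /pr cardsT card_bool_ffun natrX divff//.
  rewrite big_cons exprS.
  have dep : depends_on (\bigcup_(l <- s) S l) (\bigcap_(l <- s) E l).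
    elim: s {IHs js us} => [|l s IHs] w w'; first by rewrite !big_nil !inE.
    rewrite !big_cons => ww'; rewrite !inE => /andP[wE ws]; apply/andP; split.
      by apply: (SE l) wE => i iS; apply: ww'; rewrite inE iS.
    by apply: IHs ws => i iS; apply: ww'; rewrite inE iS orbT.
  apply: le_trans (pr_indep R (SE j) dep _) _.
    rewrite -setI_eq0 big_distrr /= big_seq big1// => l ls.
    apply/eqP; rewrite setI_eq0; apply: dis.
    by apply: contraNneq js => ->.
  by apply: ler_pM; rewrite ?pr_ge0// IHs.
apply: le_trans (_ : \sum_(A : {set J} | (#|J| <= 2 * #|A|)%N)
    pr R (\bigcap_(j in A) E j) <= _).
  apply: pr_bigcup => w; rewrite inE => hw; exists [set j | w \in E j] => //.
  by apply/finset.bigcapP => j; rewrite inE.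
apply: le_trans (_ : \sum_(A : {set J} | (#|J| <= 2 * #|A|)%N) p ^+ (#|J|./2) <= _).
  apply: ler_sum => A hA; rewrite -big_enum /=.
  apply: le_trans (inter _ (enum_uniq _)) _.
  by rewrite -cardE ler_wiXn2l ?p0// -(doubleK #|A|) half_leq// -mul2n.
rewrite sumr_const -[X in X <= _]mulr_natl ler_wpM2r ?exprn_ge0//.
rewrite -natrX ler_nat; apply: leq_trans (max_card _) _.
by rewrite -cardsT -powersetT card_powerset cardsT.
Qed.

(** Markov's inequality for the number of indices that fail. *)
Lemma pr_most_fail (R : realFieldType) (I J : finType) (E : J -> {set {ffun I -> bool}})
    (p : R) :
  (0 < #|J|)%N -> (forall j, pr R (E j) <= p) ->
  pr R [set w | (#|J| <= 2 * #|[set j | w \in E j]|)%N] <= 2 * p.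
Proof.
move=> J0 Ep; set F := [set w | _].
have p0 : (0 : R) < 2 ^+ #|I| by rewrite exprn_gt0.
have key : (#|F| * #|J| <= 2 * \sum_j #|E j|)%N.
  have -> : (\sum_j #|E j| = \sum_w #|[set j | w \in E j]|)%N.
    under eq_bigr do rewrite -sum1_card.
    under [RHS]eq_bigr do rewrite -sum1_card.
    rewrite (exchange_big_dep xpredT)//=; apply: eq_bigr => w _.
    by apply: eq_bigl => j; rewrite inE.
  rewrite -sum_nat_const big_distrr /=.
  rewrite [X in (_ <= X)%N](bigID (mem F)) /= -[X in (X <= _)%N]addn0 leq_add//.
  by apply: leq_sum => w; rewrite inE.
have : #|F|%:R * #|J|%:R <= 2 * \sum_j #|E j|%:R :> R.
  by rewrite -natr_sum -!natrM ler_nat.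
have h : \sum_j #|E j|%:R <= #|J|%:R * (p * 2 ^+ #|I|).
  rewrite -[X in X%:R * _]card_ord' || idtac.
  apply: le_trans (_ : \sum_(j : J) p * 2 ^+ #|I| <= _).
    by apply: ler_sum => j _; rewrite -ler_pdivrMr//; apply: Ep.
  by rewrite sumr_const mulr_natl.
have J0' : (0 : R) < #|J|%:R by rewrite ltr0n.
move=> k; rewrite /pr ler_pdivrMr// -(ler_pM2r J0').
by apply: le_trans k _; nra.
Qed.

(** Weighting ['C(n, k)] by [15 ^- k] in the binomial formula; the base [16 / 15]
    is small enough for its cube to stay well below 2. *)
Lemma binom_sum_le (R : realFieldType) n D :
  (binom_sum n D)%:R <= (16 / 15) ^+ n * 15 ^+ D :> R.
Proof.
have -> : (16 / 15 : R) = 1 + 15^-1 by field.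
rewrite exprDn mulr_suml /binom_sum natr_sum.
have [Dn|nD] := leqP D n.
  rewrite -(big_mkord xpredT (fun k => 'C(n, k)%:R : R)).
  rewrite -(big_mkord xpredT (fun k => (1 ^+ (n - k) * 15^-1 ^+ k *+ 'C(n, k)) * 15 ^+ D : R)).
  rewrite [X in _ <= X](big_cat_nat (n := D.+1))//= -[X in X <= _]addr0 lerD//.
    rewrite big_nat [X in _ <= X]big_nat; apply: ler_sum => k /andP[_ kD].
    rewrite expr1n mul1r -[_ ^+ _ *+ _]mulr_natl -mulrA ler_peMr//.
    rewrite exprVn ler_pdivlMl ?exprn_gt0// mulr1 ler_weXn2l//; lra.
  by apply: sumr_ge0 => k _; rewrite expr1n mul1r mulr_ge0 ?mulrn_wge0 ?exprn_ge0.
apply: le_trans (_ : \sum_(k < n.+1) 'C(n, k)%:R <= _).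
  rewrite -(big_mkord xpredT (fun k => 'C(n, k)%:R : R)).
  rewrite (big_cat_nat (n := n.+1))//=; last exact: ltnW.
  rewrite big_mkord -[X in _ <= X]addr0 lerD2l big_nat big1// => k /andP[nk _].
  by rewrite bin_small.
apply: ler_sum => k _.
rewrite expr1n mul1r -[_ ^+ _ *+ _]mulr_natl -mulrA ler_peMr//.
rewrite exprVn ler_pdivlMl ?exprn_gt0// mulr1 ler_weXn2l//; first by lra.
by have := ltn_ord k; nat_lia.
Qed.

(** * Failure of a rectangle *)

Definition potential (R : realFieldType) (Vbar : R) (K : {fset site})
    (w : {ffun K -> bool}) (c : site) : R :=
  if insub c is Some y then (if w y then Vbar else 0) else 0.

(** With [e = d1 + d2] and [f = - d2] for orthogonal unit vectors [d1] and [d2],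
    going from [(i, j)] to [(i + 1, j + 1)] adds [d1] and going to
    [(i + 1, j - 1)] adds [d2]: diagonal neighbours become lattice neighbours, and
    the pairs with [i + j] even enumerate the lattice without repetition. *)
Definition frame_site (p e f : site) (i j : nat) : site :=
  p + e *+ (i + j)./2 + f *+ j.

Definition is_frame (e f : site) : Prop :=
  forall m n m' n' : nat, e *+ m + f *+ n = e *+ m' + f *+ n' -> m = m' /\ n = n'.

Definition frame_potential (R : realFieldType) (Vbar : R) (K : {fset site})
    (w : {ffun K -> bool}) (p e f : site) (i j : nat) : R :=
  potential Vbar w (frame_site p e f i j).

(** The exponent [4 * a] exceeds the loss [T' + a + 1] of the a priori bound, and
    [4 * h + 8] allows for a growth by [G ^ 2] on each of the [2 * h + 4] rows. *)
Definition rect_fails (R : realFieldType) (Vbar lambda0 delta G : R)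
    (K : {fset site}) (p e f : site) (a h : nat) : {set {ffun K -> bool}} :=
  [set w | `[< exists t T' (Zc : {set 'I_a.+1}),
     [/\ (1 < t < T')%N, (T' <= h.*2 + 3)%N, odd (T' - t), (#|Zc| <= h)%N &
       exceptional (frame_potential Vbar w p e f) lambda0 delta
         (G ^- (4 * a)) (G ^+ (4 * h + 8)) t T' Zc] >]].

Lemma frame_site_inj p e f i j i' j' : is_frame e f ->
  ~~ odd (i + j) -> ~~ odd (i' + j') ->
  frame_site p e f i j = frame_site p e f i' j' -> i = i' /\ j = j'.
Proof.
move=> ef ij ij'; rewrite /frame_site -!addrA => /addrI/ef[h jj].
by move: h ij ij'; rewrite jj => *; split => //; nat_lia.
Qed.

Lemma potential_bound (R : realFieldType) (Vbar lambda : R) (K : {fset site})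
    (w : {ffun K -> bool}) c :
  2 <= Vbar -> - 2^-1 <= lambda <= 8 + 2^-1 ->
  `|4 + potential Vbar w c - lambda| <= 4 * Vbar.
Proof.
move=> V2 /andP[l0 l8]; rewrite ler_norml /potential.
by case: insub => [y|]; [case: (w y)|]; apply/andP; split; lra.
Qed.

Lemma card_small_sets (I : finType) h :
  #|[set A : {set I} | (#|A| <= h)%N]| = binom_sum #|I| h.
Proof.
rewrite -sum1_card (partition_big (fun A : {set I} => inord #|A| : 'I_h.+1) xpredT)//=.
apply: eq_bigr => k _; rewrite sum1_card -card_draws; apply: eq_card => A.
rewrite !inE -topredE /= !inE; apply/andP/eqP => [[Ah /eqP <-]|AE].
  by rewrite inordK.
by rewrite AE -ltnS ltn_ord; split => //; apply/eqP/val_inj; rewrite /= inordK.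
Qed.

(** A union bound over the two rows and the set [Zc], each case being
    controlled by [card_exceptional] after resampling the potential on row [t]. *)
Lemma pr_rect_fails (R : realFieldType) (Vbar lambda0 delta G : R)
    (K : {fset site}) (p e f : site) (a h n : nat) :
  is_frame e f -> 2 <= Vbar -> 0 <= lambda0 <= 8 ->
  (h.*2 + 4 <= a)%N -> (n.*2 < a)%N ->
  1 + (a + (h.*2 + 4))%:R * (4 * Vbar + 4) <= G ->
  0 <= delta <= G ^- (4 * a + (4 * h + 8)) ->
  (forall i j, (i <= a)%N -> (j <= h.*2 + 4)%N -> ~~ odd (i + j) ->
     frame_site p e f i j \in K) ->
  pr R (rect_fails Vbar lambda0 delta G K p e f a h) <=
    ((h.*2 + 4) ^ 2 * binom_sum a.+1 h * binom_sum n (3 * h + 3))%:R / 2 ^+ n.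
Proof.
move=> ef V2 /andP[l0 l8] ha na G1 /andP[d0 d1] sK.
have ah1 : 1 <= (a + (h.*2 + 4))%:R :> R by rewrite ler1n; nat_lia.
have G5 : 5 <= G by nra.
have G0 : 0 < G by lra.
have G1' : 1 <= G by lra.
have Gk k : 0 < G ^+ k by rewrite exprn_gt0.
have Gk1 k : 1 <= G ^+ k by rewrite exprn_ege1//; lra.
pose J := ('I_(h.*2 + 4) * 'I_(h.*2 + 4) * {set 'I_a.+1})%type.
pose E (z : J) : {set {ffun K -> bool}} := [set w | `[<
  exceptional (frame_potential Vbar w p e f) lambda0 delta
         (G ^- (4 * a)) (G ^+ (4 * h + 8)) z.1.1 z.1.2 z.2 >]].
pose P (z : J) := [&& (1 < z.1.1)%N, (z.1.1 < z.1.2)%N, odd (z.1.2 - z.1.1) & (#|z.2| <= h)%N].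
apply: le_trans (_ : \sum_(z | P z) pr R (E z) <= _).
  apply: pr_bigcup => w; rewrite !inE => -[t [T' [Zc [/andP[t1 tT] T'h oT Zh ex]]]].
  have T'2 : (T' < h.*2 + 4)%N by nat_lia.
  exists (Ordinal (ltn_trans tT T'2), Ordinal T'2, Zc); last by rewrite inE; apply/asboolP.
  by rewrite /P /= t1 tT oT Zh.
have bound z : P z -> pr R (E z) <= (binom_sum n (3 * h + 3))%:R / 2 ^+ n.
  case: z => [[t T'] Zc] /and4P[/= t1 tT oT Zh].
  have rK (k : 'I_n) : frame_site p e f (row_pos t k) t \in K.
    apply: sK; [|by rewrite ltnW|]; rewrite /row_pos; have := ltn_ord k; nat_lia.
  pose r (k : 'I_n) : K := [` rK k]%fset.
  have ev k : ~~ odd (row_pos t k + t) by rewrite /row_pos; nat_lia.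
  have rinj : injective r.
    move=> k l /(congr1 val) /= /(frame_site_inj ef (ev k) (ev l))[h1 _].
    by apply/val_inj => /=; move: h1; rewrite /row_pos; nat_lia.
  apply: (pr_resample _ rinj) => w.
  apply: leq_trans (_ : (binom_sum n (T' + #|Zc|) <= _)%N); last first.
    apply: leq_binom_sum; have := ltn_ord T'; have : (#|Zc| <= h)%N := Zh.
    by set c := #|_|; set u := nat_of_ord T'; clearbody c u; clear; lia.
  have T'h : (T' <= h.*2 + 3)%N by have := ltn_ord T'; nat_lia.
  apply: (@card_exceptional R (frame_potential Vbar w p e f) lambda0 delta (G ^- (4 * a))
     (G ^+ (4 * h + 8)) Vbar (4 * Vbar) G a t T' n Zc) => //.
  - exact: ltnW.
  - rewrite d0; apply: le_trans d1 _.
    rewrite lef_pV2 ?posrE ?Gk//.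
    apply: le_trans (_ : G ^+ 1 <= _); first by rewrite expr1; lra.
    by rewrite ler_weXn2l//; nat_lia.
  - rewrite -ler_pdivlMr//; apply: le_trans d1 _.
    by rewrite exprD invfM.
  - by lra.
  - apply: le_trans G1; rewrite lerD2l ler_wpM2r//; first by lra.
    by rewrite ler_nat; nat_lia.
  - rewrite mulrC ltr_pdivrMr//.
    apply: lt_le_trans (_ : 4^-1 * G ^+ ((T' + a).+2) <= _).
      rewrite [G ^+ (T' + a).+2]exprS mulrA -[X in X < _]mul1r ltr_pM2r//; lra.
    rewrite ler_pM2l ?invr_gt0// ler_weXn2l//.
    by have := ltn_ord T'; nat_lia.
  - by rewrite ler_norml; apply/andP; split; lra.
  - move=> i j _ _ _ _; apply: potential_bound => //; apply/andP; split; lra.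
  - move=> x; rewrite !inE => xE; exists (frame_potential Vbar (resample r w x) p e f).
    split => //.
      move=> k; rewrite /frame_potential /potential.
      have -> : insub (frame_site p e f (row_pos t k) t) = Some (r k) :> option K.
        by case: insubP => [y _ yE|]; [congr Some; exact/val_inj|rewrite rK].
      by rewrite resample_row.
    move=> i j ia jT jt ij; rewrite /frame_potential /potential.
    case: insubP => // y yK yE; rewrite resample_off// => k.
    apply/eqP => rk; move: yE; rewrite -rk /= => /(frame_site_inj ef (ev k) ij)[_ tj].
    by rewrite tj eqxx in jt.
apply: le_trans (ler_sum _ bound) _.
rewrite sumr_const -[X in X <= _]mulr_natl natrM -[X in _ <= X]mulrA ler_wpM2r//.
rewrite ler_nat.
apply: leq_trans (_ : #|finset.setX [set: 'I_(h.*2 + 4) * 'I_(h.*2 + 4)]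
    [set A : {set 'I_a.+1} | (#|A| <= h)%N]| <= _)%N.
  apply/subset_leq_card/fintype.subsetP => z; rewrite !inE => /and4P[_ _ _].
  by [].
by rewrite cardsX cardsT card_prod !card_ord card_small_sets card_ord mulnn.
Qed.

(** * Numerical bound for the failure of a rectangle *)

(** An even number, so that the corners of the enlarged rectangles are lattice
    sites. *)
Definition step (rho : nat) : nat := (rho %/ 256).*2.

Lemma exp_mono (R : realFieldType) (x y : R) n : 0 <= x -> x <= y -> x ^+ n <= y ^+ n.
Proof.
by move=> x0 xy; apply: lerXn2r; rewrite ?nnegrE// (le_trans x0).
Qed.

(** The two binomial sums cost at most [(16 / 15) ^ (3 * rho)] and factors
    exponential in [h]. The former is beaten by [2 ^ rho] and leaves, relative to
    the target, a factor [(7 / 10) ^ rho]; this is at most [2 ^- (64 * h)], as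
    [rho >= 128 * h], and absorbs the latter. *)
Lemma rect_count_le (R : realFieldType) (rho a h : nat) :
  (0 < h)%N -> (128 * h <= rho)%N -> (a <= rho.*2 + h.*2)%N ->
  4 * (((h.*2 + 4) ^ 2 * binom_sum a.+1 h * binom_sum rho.-1 (3 * h + 3))%:R
    / 2 ^+ rho.-1) <= (9 / 10) ^+ rho :> R.
Proof.
move=> h0 hr ar.
have rho0 : (0 < rho)%N by nat_lia.
have p2 k : (0 : R) < 2 ^+ k by rewrite exprn_gt0.
have q1 k : (0 : R) < (16 / 15) ^+ k by rewrite exprn_gt0// divr_gt0.
have q5 k : (0 : R) < 15 ^+ k by rewrite exprn_gt0.
have bs1 : (binom_sum a.+1 h)%:R <= (16 / 15) ^+ (rho.*2 + h.*2).+1 * 15 ^+ h :> R.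
  apply: le_trans (binom_sum_le R _ _) _; rewrite ler_pM2r//.
  by rewrite ler_weXn2l//; lra.
have bs2 := binom_sum_le R rho.-1 (3 * h + 3).
have quad : (h.*2 + 4)%:R ^+ 2 <= 2 ^+ (h.*2 + 6) :> R.
  have hh : (h.*2 + 4)%:R <= 2 ^+ (h + 3) :> R.
    rewrite -natrX ler_nat.
    have := ltn_expl (h + 2) (isT : (1 < 2)%N).
    by rewrite [(h + 3)%N]addnS expnS; nat_lia.
  have -> : (h.*2 + 6)%N = ((h + 3) * 2)%N by nat_lia.
  by rewrite exprM !expr2 ler_pM.
have prod : ((h.*2 + 4) ^ 2 * binom_sum a.+1 h * binom_sum rho.-1 (3 * h + 3))%:R
   <= 2 ^+ (h.*2 + 6) * ((16 / 15) ^+ (rho * 3 + h.*2) * 15 ^+ (4 * h + 3)) :> R.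
  rewrite !natrM -expr2.
  apply: le_trans (ler_pM _ _ (ler_pM _ _ quad bs1) bs2) _ => //.
  rewrite -!mulrA ler_pM2l//.
  have -> : (16 / 15) ^+ (rho * 3 + h.*2) * 15 ^+ (4 * h + 3) =
    (16 / 15) ^+ (rho.*2 + h.*2).+1 * (15 ^+ h * ((16 / 15) ^+ rho.-1 * 15 ^+ (3 * h + 3))) :> R.
    have -> : (rho * 3 + h.*2)%N = ((rho.*2 + h.*2).+1 + rho.-1)%N by nat_lia.
    have -> : (4 * h + 3)%N = (h + (3 * h + 3))%N by nat_lia.
    by rewrite !exprD; ring.
  by [].
have two : 2 ^+ rho = 2 * 2 ^+ rho.-1 :> R by rewrite -exprS prednK.
rewrite mulrA ler_pdivrMr//.
apply: le_trans (_ : 4 * (2 ^+ (h.*2 + 6) * ((16 / 15) ^+ (rho * 3 + h.*2) * 15 ^+ (4 * h + 3))) <= _).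
  by rewrite ler_pM2l.
rewrite -(ler_pM2l (_ : (0 : R) < 2))// [X in _ <= X]mulrCA -two.
have e1 : (16 / 15) ^+ (rho * 3 + h.*2) <= (7 / 10 * (9 / 5)) ^+ rho * 2 ^+ h :> R.
  rewrite exprD mulnC -muln2 [(h * 2)%N]mulnC !exprM.
  by apply: ler_pM; rewrite ?exprn_ge0//; apply: exp_mono;
    rewrite ?exprn_ge0// !exprS expr0; lra.
have e2 : 15 ^+ (4 * h + 3) <= 2 ^+ (4 * (4 * h + 3)) :> R.
  by rewrite [X in _ <= X]exprM; apply: exp_mono => //; rewrite !exprS expr0; lra.
have e3 : (7 / 10) ^+ rho * 2 ^+ (64 * h) <= 1 :> R.
  apply: le_trans (_ : (7 / 10) ^+ (2 * (64 * h)) * 2 ^+ (64 * h) <= _).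
    have a1 : 0 <= 7 / 10 :> R by lra.
    have a2 : 7 / 10 <= 1 :> R by lra.
    by rewrite ler_pM2r// ler_wiXn2l//; nat_lia.
  rewrite exprM -exprMn; apply: exprn_ile1.
    by rewrite !exprS expr0; lra.
  by rewrite !exprS expr0; lra.
have -> : (9 / 10) ^+ rho * 2 ^+ rho = (9 / 5) ^+ rho :> R.
  by rewrite -exprMn; congr (_ ^+ _); field.
rewrite [(7 / 10 * _) ^+ _]exprMn in e1.
set x := (7 / 10) ^+ rho in e1 e3.
have x0 : 0 < x by rewrite exprn_gt0//; lra.
set y := (9 / 5) ^+ rho in e1 *.
have y0 : 0 < y by rewrite exprn_gt0//; lra.
apply: le_trans (_ : 2 * (4 * (2 ^+ (h.*2 + 6) * ((x * y * 2 ^+ h) * 2 ^+ (4 * (4 * h + 3))))) <= _).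
  by rewrite !ler_pM2l//; apply: ler_pM; [exact: ltW (q1 _)|exact: ltW (q5 _)|exact: e1|exact: e2].
have -> : 2 * (4 * (2 ^+ (h.*2 + 6) * ((x * y * 2 ^+ h) * 2 ^+ (4 * (4 * h + 3))))) =
    x * 2 ^+ (19 * h + 21) * y.
  have -> : (19 * h + 21)%N = (1 + 2 + (h.*2 + 6) + h + 4 * (4 * h + 3))%N by nat_lia.
  by rewrite !exprD expr1; ring.
rewrite -[X in _ <= X]mul1r ler_pM2r//; apply: le_trans e3.
have a1 : 1 <= 2 :> R by lra.
by rewrite ler_pM2l// ler_weXn2l//; nat_lia.
Qed.

(** * Growth across a rectangle of the lattice *)

Definition dist1 (x c : site) : int := norm_one (c - x).

Definition lattice_solves (R : realFieldType) (V : site -> R) (lambda : R)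
    (u : site -> R) (c : site) : Prop :=
  u (c + (1, 0)) + u (c - (1, 0)) + u (c + (0, 1)) + u (c - (0, 1)) =
  (4 + V c - lambda) * u c.

(** Growth in the directions of increasing and decreasing [x - y], then in those of
    increasing and decreasing [x + y]. *)
Definition orientations : seq (site * site) :=
  [:: ((1, 0), (0, 1)); ((0, 1), (1, 0)); ((1, 0), (0, - 1)); ((0, - 1), (1, 0))].

(** The corner of the rectangle that starts in the rows at tilted coordinates
    [rho - 2] and [rho - 1], just inside the l1-ball of radius [rho], and is
    longer than the ball by [2 * gam] at both ends. *)
Definition rect_base (x : site) (d : site * site) (rho gam : nat) : site :=
  x - d.1 *+ gam.+1 - d.2 *+ (rho + gam).-1.

Lemma site_ext (c c' : site) : c.1 = c'.1 -> c.2 = c'.2 -> c = c'.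
Proof. by case: c c' => ? ? [? ?] /= -> ->. Qed.

Lemma pairMn (e : site) n : e *+ n = (e.1 * n%:Z, e.2 * n%:Z).
Proof.
elim: n => [|n IHn]; first by rewrite !mulr0.
by rewrite mulrS IHn; apply: site_ext => /=; rewrite -addn1 PoszD mulrDr mulr1 addrC.
Qed.

Lemma frame_siteE p e f i j : frame_site p e f i j =
  (p.1 + e.1 * ((i + j)./2)%:Z + f.1 * j%:Z, p.2 + e.2 * ((i + j)./2)%:Z + f.2 * j%:Z).
Proof. by rewrite /frame_site !pairMn. Qed.

Lemma orientation_frame d : d \in orientations -> is_frame (d.1 + d.2) (- d.2).
Proof.
rewrite !inE => /or4P[] /eqP-> m n m' n'; rewrite !pairMn /= => -[h1 h2];
  split; lia.
Qed.

Lemma orientation_sum (R : realFieldType) d (u : site -> R) c : d \in orientations ->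
  u (c + d.1) + u (c - d.1) + u (c - d.2) + u (c + d.2) =
  u (c + (1, 0)) + u (c - (1, 0)) + u (c + (0, 1)) + u (c - (0, 1)).
Proof.
have e01 : - (0, - 1) = (0, 1) :> site by [].
have e02 : (0, - 1) = - (0, 1) :> site by [].
rewrite !inE => /or4P[] /eqP-> /=; rewrite ?e01 ?e02 ?opprK; ring.
Qed.

Lemma exceptional_weaken (R : realFieldType) v (lambda0 delta eta Lam Lam' : R)
    a t T (Zc : {set 'I_a.+1}) :
  Lam <= Lam' -> exceptional v lambda0 delta eta Lam t T Zc ->
  exceptional v lambda0 delta eta Lam' t T Zc.
Proof.
move=> LL [lam [F [[h1 h2 h3 h4] h5]]]; exists lam, F; split => //; split => // i j ia jT.
exact: le_trans (h4 i j ia jT) LL.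
Qed.

(** Few large sites in the rectangle leave two consecutive rows, beyond row
    [h + 2], with at most [h] of them; unless the rectangle fails,
    [bounded_or_exceptional] then bounds [u] on all rows before these. *)
Lemma rect_growth (R : realFieldType) (Vbar lambda0 lambda delta G M : R)
    (K : {fset site}) (w : {ffun K -> bool}) (p : site) (d : site * site) (a h : nat)
    (u : site -> R) (Bd : seq site) :
  let site_at := frame_site p (d.1 + d.2) (- d.2) in
  d \in orientations -> 2 <= Vbar -> 0 <= lambda0 <= 8 ->
  (h.+1 < a./2)%N ->
  1 + (a + (h.*2 + 4))%:R * (4 * Vbar + 4) <= G ->
  `|lambda - lambda0| <= delta -> delta <= 2^-1 ->
  w \notin rect_fails Vbar lambda0 delta G K p (d.1 + d.2) (- d.2) a h ->
  (forall i j, (0 < i < a)%N -> (0 < j < h.*2 + 4)%N -> ~~ odd (i + j) ->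
     lattice_solves (potential Vbar w) lambda u (site_at i j)) ->
  0 < M ->
  (forall i j, (i <= a)%N -> (j <= 1)%N -> ~~ odd (i + j) -> `|u (site_at i j)| <= M) ->
  (forall i j, (i <= a)%N -> (j <= h.*2 + 4)%N -> ~~ odd (i + j) ->
     M < `|u (site_at i j)| -> site_at i j \in Bd) ->
  (2 * size Bd < h.+1 ^ 2)%N ->
  forall i j, (i <= a)%N -> (j <= h + 2)%N -> ~~ odd (i + j) ->
    `|u (site_at i j)| <= M * G ^+ (4 * a + (4 * h + 8)).
Proof.
move=> site_at dor V2 /andP[l0 l8] ha G1 lamd del good sol M0 uM bad few.
have ah1 : 1 <= (a + (h.*2 + 4))%:R :> R by rewrite ler1n; nat_lia.
have G5 : 5 <= G by nra.
have G1' : 1 <= G by lra.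
have ef := orientation_frame dor.
pose F i j := if odd (i + j) then 0 else u (site_at i j).
have FE i j : ~~ odd (i + j) -> F i j = u (site_at i j) by rewrite /F => /negbTE->.
have lamb : - 2^-1 <= lambda <= 8 + 2^-1.
  by move: lamd; rewrite ler_norml => /andP[? ?]; apply/andP; split; lra.
have Fev : even_supported F by move=> i j ij; rewrite /F ij.
have Fsol b : (b <= h.*2 + 4)%N ->
    solves (fun i j => 4 + frame_potential Vbar w p (d.1 + d.2) (- d.2) i j - lambda) a b F.
  move=> bh i j ia jb.
  have [ood|ev] := boolP (odd (i + j)).
    by rewrite !Fev ?addr0 ?mulr0//; nat_lia.
  have evs : [/\ ~~ odd (i.+2 + j.+2), ~~ odd (i.+2 + j), ~~ odd (i + j.+2)
    & ~~ odd (i.+1 + j.+1)] by split; nat_lia.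
  case: evs => ev1 ev2 ev3 ev4; rewrite !FE//.
  have := sol i.+1 j.+1 _ _ ev4.
  rewrite /lattice_solves -(orientation_sum u _ dor) => <-; [|nat_lia|nat_lia].
  have half k l : ((k.+1 + l.+1)./2 = (k + l)./2.+1)%N by rewrite addSn addnS.
  have -> : site_at i.+2 j.+2 = site_at i.+1 j.+1 + d.1.
    rewrite /site_at /frame_site !half.
    by rewrite !mulrS; apply: site_ext => /=; ring.
  have -> : site_at i j = site_at i.+1 j.+1 - d.1.
    by rewrite /site_at /frame_site !half !mulrS; apply: site_ext => /=; ring.
  have -> : site_at i.+2 j = site_at i.+1 j.+1 + d.2.
    rewrite /site_at /frame_site !half.
    have -> : (i.+2 + j)./2 = (i + j)./2.+1 by [].
    by rewrite !mulrS; apply: site_ext => /=; ring.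
  have -> : site_at i j.+2 = site_at i.+1 j.+1 - d.2.
    rewrite /site_at /frame_site !half.
    have -> : (i + j.+2)./2 = (i + j)./2.+1 by rewrite !addnS.
    by rewrite !mulrS; apply: site_ext => /=; ring.
  by ring.
(* otherwise each of the [h + 1] pairs of consecutive rows has more than [h] bad
   sites, and every row belongs to at most two pairs *)
have [T [hT Th bT bT1]] : exists T, [/\ (h + 2 <= T)%N, (T < h.*2 + 3)%N,
    (#|bad_in_row F M a T| <= h)%N & (#|bad_in_row F M a T.+1| <= h)%N].
  apply: contrapT => nex; move: few; apply/negP; rewrite -leqNgt.
  pose B (k : 'I_h.+1) := (#|bad_in_row F M a (h + 2 + k)| +
                           #|bad_in_row F M a (h + 2 + k).+1|)%N.
  have Bh k : (h < B k)%N.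
    rewrite ltnNge; apply/negP => Bk; apply: nex; exists (h + 2 + k)%N.
    have := ltn_ord k; move: Bk; rewrite /B.
    set b1 := #|_|; set b2 := #|_| => Bk kh.
    by split; clearbody b1 b2; nat_lia.
  have rows (g : 'I_h.+1 -> nat) : injective g -> (forall k, (g k <= h.*2 + 4)%N) ->
      (\sum_k #|bad_in_row F M a (g k)| <= size Bd)%N.
    move=> ginj gh.
    pose P := [set z : 'I_h.+1 * 'I_a.+1 | z.2 \in bad_in_row F M a (g z.1)].
    have -> : (\sum_k #|bad_in_row F M a (g k)|)%N = #|P|.
      under eq_bigr do rewrite -sum1_card.
      rewrite pair_big_dep -sum1_card /=; apply: eq_bigl => -[k i].
      by rewrite [in RHS]inE.
    have PP z : z \in P -> ~~ odd (z.2 + g z.1) /\ M < `|u (site_at z.2 (g z.1))|.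
      rewrite !inE; case: (boolP (odd (z.2 + g z.1))) => ez; last by rewrite FE.
      by rewrite Fev// normr0 => /lt_trans-/(_ _ M0); rewrite ltxx.
    have sub z : z \in P -> site_at z.2 (g z.1) \in Bd.
      move=> /PP[ez Mz]; apply: bad => //; first by rewrite leq_ord.
    pose s (z : 'I_h.+1 * 'I_a.+1) := site_at z.2 (g z.1).
    have sinj : {in P &, injective s}.
      move=> [k i] [k' i'] /PP[/= e1 _] /PP[/= e2 _] /(frame_site_inj ef e1 e2)[h1 h2].
      by congr (_, _); [apply: ginj|apply: val_inj].
    rewrite cardE -(size_map s).
    apply: uniq_leq_size.
      rewrite map_inj_in_uniq ?enum_uniq// => z z'; rewrite !mem_enum; exact: sinj.
    by move=> c /mapP[z]; rewrite mem_enum => zP ->; apply: sub.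
  have r1 := rows (fun k => (h + 2 + k)%N) _ _.
  have r2 := rows (fun k => (h + 2 + k).+1) _ _.
  have tot : (\sum_k B k <= 2 * size Bd)%N.
    rewrite big_split /= mul2n -addnn; apply: leq_add; [apply: r1|apply: r2].
    - by move=> k l /addnI/val_inj.
    - by move=> k; have := ltn_ord k; nat_lia.
    - by move=> k l [] /addnI/val_inj.
    - by move=> k; have := ltn_ord k; nat_lia.
  apply: leq_trans tot; rewrite expnS expn1 -[X in (X * _)%N]card_ord -sum_nat_const.
  by apply: leq_sum => k _.
have GT : 1 + (a + T)%:R * (4 * Vbar + 4) <= G.
  apply: le_trans G1; rewrite lerD2l ler_wpM2r//; first by lra.
  by rewrite ler_nat; nat_lia.
have := @bounded_or_exceptional R (frame_potential Vbar w p (d.1 + d.2) (- d.2)) F lambda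
  lambda0 delta M (4 * Vbar) G a T (4 * a).
case=> //; try by nat_lia.
- by lra.
- by apply: Fsol; nat_lia.
- move=> i j _ _ _; exact: potential_bound.
- move=> i ia; split.
    have [ood|ev] := boolP (odd (i + 0)); first by rewrite Fev// normr0 ltW.
    by rewrite FE//; apply: uM.
  have [ood|ev] := boolP (odd (i + 1)); first by rewrite Fev// normr0 ltW.
  by rewrite FE//; apply: uM.
- move=> bnd i j ia jh ij; rewrite -FE//.
  apply: le_trans (bnd i j ia _) _; first by nat_lia.
  by rewrite ler_pM2l// ler_weXn2l//; nat_lia.
move=> [t [T' [Zc [/andP[t1 tT] /andP[T1 T2] oT Zh ex]]]]; exfalso.
move/negP: good; apply; rewrite inE; apply/asboolP; exists t, T', Zc; split => //.
- by rewrite t1.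
- by nat_lia.
- by apply: leq_trans Zh _; rewrite geq_max bT.
- apply: exceptional_weaken ex; rewrite ler_weXn2l//; nat_lia.
Qed.

(** * Growth of l1-balls *)

(** The last two rectangles are built on the sides already lengthened by the first
    two. *)
Definition rect_shift (rho : nat) (wide : bool) : nat := if wide then (rho %/ 256)%N else 0%N.

Definition rect_width (rho : nat) (wide : bool) : nat := (rho.*2 + rect_shift rho wide * 4)%N.

Definition rects : seq ((site * site) * bool) :=
  zip orientations [:: false; false; true; true].

Definition rect_at_fails (R : realFieldType) (Vbar lambda0 delta G : R) (K : {fset site})
    (x : site) (rho : nat) (r : (site * site) * bool) : {set {ffun K -> bool}} :=
  rect_fails Vbar lambda0 delta G K (rect_base x r.1 rho (rect_shift rho r.2))
    (r.1.1 + r.1.2) (- r.1.2) (rect_width rho r.2) (step rho).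

Definition center_fails (R : realFieldType) (Vbar lambda0 delta G : R) (K : {fset site})
    (x : site) (rho : nat) : {set {ffun K -> bool}} :=
  [set w | has (fun r => w \in rect_at_fails Vbar lambda0 delta G K x rho r) rects].

Definition dot (a b : site) : int := a.1 * b.1 + a.2 * b.2.

Lemma dist1E x c : dist1 x c = `|c.1 - x.1| + `|c.2 - x.2|.
Proof. by []. Qed.

(** The frame coordinates are the tilted coordinates relative to [x], shifted. *)
Lemma rect_site_tilt x d rho gam i j : d \in orientations -> (0 < rho)%N ->
  ~~ odd (i + j) ->
  let c := frame_site (rect_base x d rho gam) (d.1 + d.2) (- d.2) i j in
  dot (c - x) (d.1 + d.2) = i%:Z - (rho + gam.*2)%N%:Z /\
  dot (c - x) (d.1 - d.2) = j%:Z + rho%:Z - 2.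
Proof.
rewrite !inE => /or4P[] /eqP-> rho0 ij /=;
  rewrite frame_siteE /rect_base !pairMn /dot /=; split; lia.
Qed.

Lemma rect_site_surj x d rho gam c : d \in orientations -> (0 < rho)%N ->
  0 <= dot (c - x) (d.1 + d.2) + (rho + gam.*2)%N%:Z ->
  0 <= dot (c - x) (d.1 - d.2) - rho%:Z + 2 ->
  exists i j, [/\ ~~ odd (i + j), i%:Z = dot (c - x) (d.1 + d.2) + (rho + gam.*2)%N%:Z,
    j%:Z = dot (c - x) (d.1 - d.2) - rho%:Z + 2 &
    frame_site (rect_base x d rho gam) (d.1 + d.2) (- d.2) i j = c].
Proof.
move=> dor rho0 S0 T0.
exists (absz (dot (c - x) (d.1 + d.2) + (rho + gam.*2)%N%:Z)).
exists (absz (dot (c - x) (d.1 - d.2) - rho%:Z + 2)).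
move: dor S0 T0; rewrite !inE => /or4P[] /eqP->; rewrite /dot /= => S0 T0;
  (split; [lia|lia|lia|]); rewrite frame_siteE /rect_base !pairMn;
  rewrite [RHS]surjective_pairing; congr (_, _) => /=; lia.
Qed.

Lemma dist1_tilt x c d n : d \in orientations ->
  (dist1 x c <= n) = (`|dot (c - x) (d.1 + d.2)| <= n) && (`|dot (c - x) (d.1 - d.2)| <= n).
Proof.
rewrite !inE dist1E => /or4P[] /eqP->; rewrite /dot /=; lia.
Qed.

Lemma rects_orientation r : r \in rects -> r.1 \in orientations.
Proof. by rewrite !inE => /or4P[] /eqP->. Qed.

Lemma rect_site_ball x r rho i j : r \in rects -> (512 <= rho)%N -> ~~ odd (i + j) ->
  (i <= rect_width rho r.2)%N -> (j <= (step rho).*2 + 4)%N ->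
  dist1 x (frame_site (rect_base x r.1 rho (rect_shift rho r.2)) (r.1.1 + r.1.2)
     (- r.1.2) i j) <= (rho.*2)%:Z.
Proof.
move=> rr rho5 ij ia jh.
rewrite (dist1_tilt _ _ _ (rects_orientation rr)).
have rho0 : (0 < rho)%N by lia.
have [-> ->] := rect_site_tilt x (rect_shift rho r.2) (rects_orientation rr) rho0 ij.
move: ia jh; rewrite /rect_width /rect_shift /step.
by case: (r.2); lia.
Qed.

Lemma pr_center_fails (R : realFieldType) (Vbar lambda0 delta G : R) (K : {fset site})
    (x : site) (rho : nat) :
  (512 <= rho)%N -> 2 <= Vbar -> 0 <= lambda0 <= 8 ->
  1 + (4 * rho)%:R * (4 * Vbar + 4) <= G ->
  0 <= delta -> (forall n, (n <= 20 * rho)%N -> delta <= G ^- n) ->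
  (forall c, dist1 x c <= (rho.*2)%:Z -> c \in K) ->
  pr R (center_fails Vbar lambda0 delta G K x rho) <= (9 / 10) ^+ rho.
Proof.
move=> rho5 V2 l08 G1 d0 dG xK.
have one r : r \in rects ->
    pr R (rect_at_fails Vbar lambda0 delta G K x rho r) <= (9 / 10) ^+ rho / 4.
  move=> rr; have rho0 : (0 < rho)%N by lia.
  rewrite ler_pdivlMr// mulrC.
  have wle : (rect_width rho r.2 <= rho.*2 + (step rho).*2)%N.
    by rewrite /rect_width /rect_shift /step; case: r.2; lia.
  have wge : (rho.*2 <= rect_width rho r.2)%N by rewrite /rect_width leq_addr.
  have sr : (128 * step rho <= rho)%N by rewrite /step; lia.
  have s0 : (0 < step rho)%N by rewrite /step; lia.
  have [n1 n2 n3 n4] : [/\ ((step rho).*2 + 4 <= rect_width rho r.2)%N,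
      (rho.-1.*2 < rect_width rho r.2)%N,
      (rect_width rho r.2 + ((step rho).*2 + 4) <= 4 * rho)%N &
      (4 * rect_width rho r.2 + (4 * step rho + 8) <= 20 * rho)%N].
    move: wle wge sr s0; clear -rho5; move: (rect_width _ _) (step rho) => a s.
    by split; lia.
  apply: le_trans (rect_count_le R s0 sr wle); rewrite ler_pM2l//.
  apply: pr_rect_fails => //.
  - exact/orientation_frame/rects_orientation.
  - by apply: le_trans G1; rewrite lerD2l ler_wpM2r ?ler_nat//; lra.
  - by rewrite d0/= dG.
  - move=> i j ia jh ij; apply: xK; exact: rect_site_ball.
apply: le_trans (_ : \sum_(k < 4) pr R (rect_at_fails Vbar lambda0 delta G K x rho
    (nth ((0, 0), false) rects k)) <= _).
  apply: pr_bigcup => w; rewrite inE => /(has_nthP ((0, 0), false))[k k4 wk].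
  by exists (Ordinal (k4 : (k < 4)%N)).
apply: le_trans (_ : \sum_(k < 4) (9 / 10) ^+ rho / 4 <= _).
  by apply: ler_sum => k _; apply: one; rewrite mem_nth// ltn_ord.
by rewrite sumr_const card_ord -[X in X <= _]mulr_natr divfK.
Qed.

(** An l1-ball is a square in the tilted coordinates. Two rectangles extend it in
    one of the directions, and two longer ones extend the result in the other. *)
Lemma ball_growth (R : realFieldType) (Vbar lambda0 lambda delta G M : R)
    (K : {fset site}) (w : {ffun K -> bool}) (x : site) (rho : nat)
    (u : site -> R) (Bd : seq site) :
  (512 <= rho)%N -> 2 <= Vbar -> 0 <= lambda0 <= 8 ->
  1 + (4 * rho)%:R * (4 * Vbar + 4) <= G ->
  `|lambda - lambda0| <= delta -> delta <= 2^-1 ->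
  w \notin center_fails Vbar lambda0 delta G K x rho ->
  (forall c, dist1 x c <= (rho.*2)%:Z -> lattice_solves (potential Vbar w) lambda u c) ->
  1 <= M ->
  (forall c, dist1 x c <= rho%:Z -> `|u c| <= M) ->
  (forall c, dist1 x c <= (rho.*2)%:Z -> 1 <= `|u c| -> c \in Bd) ->
  (2 * size Bd < (step rho).+1 ^ 2)%N ->
  forall c, dist1 x c <= (rho + step rho)%N%:Z -> `|u c| <= M * G ^+ (40 * rho).
Proof.
move=> rho5 V2 l08 G1 lamd del good sol M1 uM bad few.
have rho0 : (0 < rho)%N by int_lia.
have G1' : 1 <= G.
  by apply: le_trans G1; rewrite lerDl; apply: mulr_ge0; [exact: ler0n|lra].
have GM N k : 1 <= N -> N <= N * G ^+ k by move=> N1; rewrite ler_peMr ?exprn_ege1//; lra.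
have one r N : r \in rects -> 1 <= N ->
    (forall c, `|dot (c - x) (r.1.1 + r.1.2)| <= (rho + (rect_shift rho r.2).*2)%N%:Z ->
       rho%:Z - 2 <= dot (c - x) (r.1.1 - r.1.2) <= rho%:Z - 1 -> `|u c| <= N) ->
    forall c, `|dot (c - x) (r.1.1 + r.1.2)| <= (rho + (rect_shift rho r.2).*2)%N%:Z ->
       rho%:Z - 2 <= dot (c - x) (r.1.1 - r.1.2) <= (rho + step rho)%N%:Z ->
       `|u c| <= N * G ^+ (20 * rho).
  move=> rr N1 uN c Sc Tc.
  have ror := rects_orientation rr.
  have wge : (rho.*2 <= rect_width rho r.2)%N by rewrite /rect_width leq_addr.
  have wle : (rect_width rho r.2 <= rho.*2 + (step rho).*2)%N.
    by rewrite /rect_width /rect_shift /step; case: r.2; int_lia.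
  have wE : (rect_width rho r.2 = (rho + (rect_shift rho r.2).*2).*2)%N.
    by rewrite /rect_width; int_lia.
  have sr : (128 * step rho <= rho)%N by rewrite /step; int_lia.
  have [n1 n2 n3] : [/\ ((step rho).+1 < (rect_width rho r.2)./2)%N,
      (rect_width rho r.2 + ((step rho).*2 + 4) <= 4 * rho)%N &
      (4 * rect_width rho r.2 + (4 * step rho + 8) <= 20 * rho)%N].
    move: wle wge sr; clear -rho5; move: (rect_width _ _) (step rho) => a s.
    by split; lia.
  have S0 : 0 <= dot (c - x) (r.1.1 + r.1.2) + (rho + (rect_shift rho r.2).*2)%N%:Z.
    by int_lia.
  have T0 : 0 <= dot (c - x) (r.1.1 - r.1.2) - rho%:Z + 2 by int_lia.
  have [i [j [ij iE jE cE]]] := rect_site_surj ror rho0 S0 T0.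
  have ia : (i <= rect_width rho r.2)%N by rewrite wE; int_lia.
  have jh : (j <= step rho + 2)%N by int_lia.
  apply: le_trans (_ : N * G ^+ (4 * rect_width rho r.2 + (4 * step rho + 8)) <= _); last first.
    by rewrite ler_pM2l ?ler_weXn2l//; lra.
  rewrite -cE.
  apply: (@rect_growth R Vbar lambda0 lambda delta G N K w
    (rect_base x r.1 rho (rect_shift rho r.2)) r.1 _ (step rho) u Bd) => //.
  - by apply: le_trans G1; rewrite lerD2l ler_wpM2r ?ler_nat//; lra.
  - by move: good; rewrite inE => /hasPn/(_ r rr).
  - move=> k l /andP[_ ka] /andP[_ lh] kl; apply: sol.
    by apply: rect_site_ball => //; exact: ltnW.
  - by lra.
  - move=> k l ka l1 kl.
    have [h1 h2] := rect_site_tilt x (rect_shift rho r.2) ror rho0 kl.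
    by apply: uN; rewrite ?h1 ?h2; int_lia.
  - move=> k l ka lh kl Nu; apply: bad; first exact: rect_site_ball.
    by lra.
have r0 : nth ((0, 0), false) rects 0 \in rects by rewrite mem_nth.
have r1 : nth ((0, 0), false) rects 1 \in rects by rewrite mem_nth.
have r2 : nth ((0, 0), false) rects 2 \in rects by rewrite mem_nth.
have r3 : nth ((0, 0), false) rects 3 \in rects by rewrite mem_nth.
pose N := M * G ^+ (20 * rho).
have MN : M <= N by exact: GM.
have N1 : 1 <= N by exact: le_trans MN.
have EW (c : site) : `|(c.1 - x.1) + (c.2 - x.2)| <= rho%:Z ->
    `|(c.1 - x.1) - (c.2 - x.2)| <= (rho + step rho)%N%:Z -> `|u c| <= N.
  move=> Sc Tc; have [cb|cb] := boolP (dist1 x c <= rho%:Z).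
    by apply: le_trans (uM c cb) MN.
  rewrite dist1E in cb.
  have [pos|neg] : 0 <= (c.1 - x.1) - (c.2 - x.2) \/ (c.1 - x.1) - (c.2 - x.2) <= 0 by int_lia.
    apply: (one _ M r0 M1); rewrite /dot /rect_shift /= ?addn0; [|int_lia|int_lia].
    by move=> c' h1 h2; apply: uM; rewrite dist1E; int_lia.
  apply: (one _ M r1 M1); rewrite /dot /rect_shift /= ?addn0; [|int_lia|int_lia].
  by move=> c' h1 h2; apply: uM; rewrite dist1E; int_lia.
have -> : M * G ^+ (40 * rho) = N * G ^+ (20 * rho).
  by rewrite /N -mulrA -exprD; congr (_ * _ ^+ _); int_lia.
move=> c; rewrite dist1E => cb.
have [Sc|Sc] := boolP (`|(c.1 - x.1) + (c.2 - x.2)| <= rho%:Z).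
  by apply: le_trans (EW c Sc _) (GM _ _ N1); int_lia.
have sE : (step rho = (rho %/ 256).*2)%N by [].
have [pos|neg] : 0 <= (c.1 - x.1) + (c.2 - x.2) \/ (c.1 - x.1) + (c.2 - x.2) <= 0 by int_lia.
  apply: (one _ N r2 N1); rewrite /dot /rect_shift /= ?addn0; [|int_lia|int_lia].
  by move=> c' h1 h2; apply: EW; int_lia.
apply: (one _ N r3 N1); rewrite /dot /rect_shift /= ?addn0; [|int_lia|int_lia].
by move=> c' h1 h2; apply: EW; int_lia.
Qed.

(** * All scales around one centre *)

Definition in_ball (x : site) (n : nat) : pred site := fun c => dist1 x c <= n%:Z.

(** The exponent [40 * rho] lost at radius [rho] is at most [40 * 256] times the
    gain [step rho] in radius, so the bound stays exponential in the radius. The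
    first radius costs nothing: there, the density condition means that
    there is no large site at all. *)
Lemma tower_bound (R : realFieldType) (Vbar lambda0 lambda delta G : R)
    (K : {fset site}) (w : {ffun K -> bool}) (x : site) (N : nat)
    (u : site -> R) (Bd : seq site) :
  (512 <= N)%N -> 2 <= Vbar -> 0 <= lambda0 <= 8 ->
  1 + (4 * N)%:R * (4 * Vbar + 4) <= G ->
  `|lambda - lambda0| <= delta -> delta <= 2^-1 ->
  (forall rho, (512 <= rho < N)%N -> w \notin center_fails Vbar lambda0 delta G K x rho) ->
  (forall c, dist1 x c <= (N.*2)%:Z -> lattice_solves (potential Vbar w) lambda u c) ->
  (forall c, dist1 x c <= (N.*2)%:Z -> 1 <= `|u c| -> c \in Bd) ->
  (forall rho, (512 <= rho <= N)%N ->
     (512 ^ 2 * count (in_ball x rho.*2) Bd < rho ^ 2)%N) ->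
  exists2 rho, (N <= rho <= N.*2)%N &
    forall c, dist1 x c <= rho%:Z -> `|u c| <= G ^+ (40 * 256 * rho).
Proof.
move=> N5 V2 l08.
have Gge n : 1 + (4 * n)%:R * (4 * Vbar + 4) <= G -> 1 <= G.
  by apply: le_trans; rewrite lerDl; apply: mulr_ge0; [exact: ler0n|lra].
elim: N N5 => [//|N IHN].
rewrite leq_eqVlt => /orP[/eqP<-|]; last rewrite ltnS => N5;
  move=> G1 lamd del good sol bad light.
  have G1' := Gge _ G1.
  exists 512; first by [].
  move=> c cx; have := light 512 isT.
  rewrite -[X in (_ < X)%N]muln1 ltn_pmul2l ?expn_gt0// ltnS leqn0 => /eqP n0.
  have nbad : ~ 1 <= `|u c|.
    move=> uc; have cx2 : dist1 x c <= ((512%N).*2)%:Z by apply: le_trans cx _.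
    have cB := bad c cx2 uc.
    have : has (in_ball x (512%N).*2) Bd.
      by apply/hasP; exists c.
    by rewrite has_count n0.
  apply: le_trans (_ : 1 <= _); last by rewrite exprn_ege1.
  by rewrite leNgt; apply/negP => /ltW.
have monoG n m : (n <= m)%N -> 1 + (4 * n)%:R * (4 * Vbar + 4) <= 1 + (4 * m)%:R * (4 * Vbar + 4).
  by move=> nm; rewrite lerD2l ler_wpM2r ?ler_nat ?leq_pmul2l//; lra.
have G1' := Gge _ G1.
have GN := le_trans (monoG _ _ (leqnSn N)) G1.
have [||||] := IHN N5 GN lamd del.
- by move=> rho hrho; apply: good; int_lia.
- by move=> c hc; apply: sol; int_lia.
- by move=> c hc; apply: bad; int_lia.
- by move=> rho hrho; apply: light; int_lia.
move=> rho /andP[Nr rN] Hr.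
have [Nr'|rN'] := ltnP N rho; first by exists rho => //; int_lia.
have rE : rho = N by int_lia.
subst rho.
have s0 : (0 < step N)%N by rewrite /step; int_lia.
have sN : (step N <= N)%N by rewrite /step; int_lia.
have sN2 : (40 * N <= 40 * 256 * step N)%N by rewrite /step; int_lia.
have sN3 : (N <= 256 * (step N).+1)%N by rewrite /step; int_lia.
exists (N + step N)%N; first by int_lia.
move=> c cb.
apply: le_trans (_ : G ^+ (40 * 256 * N) * G ^+ (40 * N) <= _); last first.
  by rewrite -exprD ler_weXn2l// mulnDr leq_add2l.
apply: (@ball_growth R Vbar lambda0 lambda delta G _ K w x N u
   [seq c <- Bd | in_ball x N.*2 c]) => //.
- by apply: good; rewrite N5 ltnSn.
- by move=> c' hc; apply: sol; int_lia.
- by rewrite exprn_ege1.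
- by move=> c' hc uc; rewrite mem_filter /in_ball hc bad//; int_lia.
rewrite size_filter.
have := light N _; rewrite N5 leqnSn => /(_ isT).
move: sN3; set k := count _ _; set s := (step N).+1; clear => sN3 lt.
have d0 : (0 < 256)%N by [].
have e : 512%N = (256 * 2)%N by [].
move: lt; rewrite e; move: d0 sN3; move: 256%N => q q0 sN3 lt.
have h : (N ^ 2 <= q ^ 2 * s ^ 2)%N by rewrite -expnMn leq_exp2r.
rewrite expnMn -mulnA in lt.
have := leq_trans lt h; rewrite ltn_pmul2l ?expn_gt0 ?q0//.
by apply: leq_ltn_trans; rewrite leq_mul2r orbT.
Qed.

Lemma card_ball (s : seq site) x n : uniq s ->
  (forall y : site, y \in s -> dist1 x y <= n%:Z) -> (size s <= (n.*2.+1) ^ 2)%N.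
Proof.
move=> us sx.
pose f (y : site) : 'I_n.*2.+1 * 'I_n.*2.+1 :=
  (inord (absz (y.1 - x.1 + n%:Z)), inord (absz (y.2 - x.2 + n%:Z))).
have finj (y z : site) : y \in s -> z \in s -> f y = f z -> y = z.
  move=> ys zs; have := sx y ys; have := sx z zs; rewrite !dist1E => hz hy.
  rewrite /f => -[/(congr1 val) /= h1 /(congr1 val) /= h2].
  rewrite !inordK in h1; [|int_lia|int_lia].
  rewrite !inordK in h2; [|int_lia|int_lia].
  by apply: site_ext; int_lia.
rewrite -(size_map f).
have <- : #|{: 'I_n.*2.+1 * 'I_n.*2.+1}| = (n.*2.+1 ^ 2)%N by rewrite card_prod card_ord mulnn.
by rewrite cardE; apply: uniq_leq_size => [|z _]; rewrite ?map_inj_in_uniq// mem_enum.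
Qed.

(** The covering argument for the maximal function. Remove a point of largest radius
    together with the points within 4 times this radius; the balls of the
    remaining points do not meet its ball, so the sites of [Bd] in it are
    counted once. *)
Lemma vitali (rad : site -> nat) (Kc : nat) (X Bd : seq site) : uniq X ->
  (forall x, x \in X -> (0 < rad x)%N /\
     (rad x ^ 2 <= Kc * count (in_ball x (rad x).*2) Bd)%N) ->
  (size X <= 81 * Kc * size Bd)%N.
Proof.
have [n] := ubnP (size X); elim: n X Bd => // n IHn X Bd Xn uX HX.
have exmax (s : seq site) : s != [::] ->
    exists2 x, x \in s & forall y, y \in s -> (rad y <= rad x)%N.
  elim: s => // x s IHs _; have [->|/IHs[z zs zmax]] := eqVneq s [::].
    by exists x => [|y]; rewrite ?mem_head// inE => /eqP->.
  have [le|lt] := leqP (rad x) (rad z).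
    exists z => [|t]; rewrite inE ?zs ?orbT// => /orP[/eqP->//|]; exact: zmax.
  exists x => [|t]; rewrite inE ?eqxx// => /orP[/eqP->//|/zmax h].
  exact: leq_trans h (ltnW lt).
have [->//|/exmax[x xX xmax]] := eqVneq X [::].
have [r0 rx] := HX x xX; set r := rad x in r0 rx xmax.
pose near := in_ball x (4 * r).
pose hit := in_ball x r.*2.
have cX : (count near X <= 81 * r ^ 2)%N.
  rewrite -size_filter; apply: leq_trans (_ : ((4 * r).*2.+1 ^ 2 <= _)%N).
    apply: (@card_ball _ x); first exact: filter_uniq.
    by move=> y; rewrite mem_filter => /andP[].
  have -> : 81%N = (9 ^ 2)%N by [].
  by rewrite -expnMn leq_exp2r//; int_lia.
have rest : (size [seq c <- X | predC near c] <= 81 * Kc * size [seq c <- Bd | predC hit c])%N.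
  apply: IHn; last 2 first.
  - exact: filter_uniq.
  - move=> y; rewrite mem_filter => /andP[/= ny yX]; have [y0 ry] := HX y yX.
    split=> //; apply: leq_trans ry _; rewrite leq_mul2l; apply/orP; right.
    rewrite count_filter; apply: sub_count => c /= yc; rewrite yc /=.
    rewrite /in_ball in yc; have := xmax y yX; move: ny yc; rewrite /near /hit /in_ball !dist1E; int_lia.
  rewrite -ltnS; apply: leq_trans Xn; rewrite ltnS size_filter.
  rewrite -(count_predC near X) -[X in (X < _)%N]add0n ltn_add2r -has_count.
  by apply/hasP; exists x => //; rewrite /near /in_ball dist1E; int_lia.
have := count_predC near X; have := count_predC hit Bd.
rewrite !size_filter in rest; move: rest rx cX; rewrite -/hit -/r => rest rx cX hB hX.
rewrite -hX -hB mulnDr leq_add//.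
by apply: leq_trans cX _; rewrite -mulnA leq_mul2l rx.
Qed.

(** * Independent blocks of centres *)

Lemma exceptional_ext (R : realFieldType) (v v' : nat -> nat -> R)
    (lambda0 delta eta Lam : R) a t T (Zc : {set 'I_a.+1}) :
  (forall i j, (0 < i < a)%N -> (0 < j < T)%N -> ~~ odd (i + j) -> v i j = v' i j) ->
  exceptional v lambda0 delta eta Lam t T Zc ->
  exceptional v' lambda0 delta eta Lam t T Zc.
Proof.
move=> vv' [lam [F [[h1 Fev sol h4] h5]]]; exists lam, F; split => //; split => //.
move=> i j ia jT; rewrite sol//.
have [ood|ev] := boolP (odd (i.+1 + j.+1)); first by rewrite Fev// !mulr0.
by rewrite vv'.
Qed.

(** Failures of separated centres are independent because of this. *)
Lemma center_fails_local (R : realFieldType) (Vbar lambda0 delta G : R)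
    (K : {fset site}) (x : site) (rho : nat) (w w' : {ffun K -> bool}) :
  (512 <= rho)%N ->
  (forall y : K, dist1 x (val y) <= (rho.*2)%:Z -> w y = w' y) ->
  w \in center_fails Vbar lambda0 delta G K x rho ->
  w' \in center_fails Vbar lambda0 delta G K x rho.
Proof.
move=> rho5 ww'; rewrite !inE => /hasP[r rr]; rewrite inE => wr.
apply/hasP; exists r => //; rewrite inE; move: wr.
move=> /asboolP[t [T' [Zc [h1 h2 h3 h4 ex]]]]; apply/asboolP.
exists t, T', Zc; split => //; apply: exceptional_ext ex => i j /andP[_ ia] /andP[_ jT] ij.
rewrite /frame_potential /potential; case: insubP => // y yK yE.
rewrite ww'// yE; apply: rect_site_ball => //; first exact: ltnW.
by move: jT h2; clear; int_lia.
Qed.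

Lemma geometric_tail (R : realFieldType) (z : R) (m n : nat) : 0 <= z < 1 ->
  \sum_(m <= k < n) z ^+ k <= z ^+ m / (1 - z).
Proof.
move=> /andP[z0 z1]; have z1' : 0 < 1 - z by lra.
have zm : 0 <= z ^+ m by rewrite exprn_ge0.
have [nm|mn] := leqP n m; first by rewrite big_geq// divr_ge0// ltW.
rewrite ler_pdivlMr//.
suff -> : (\sum_(m <= k < n) z ^+ k) * (1 - z) = z ^+ m - z ^+ n.
  by rewrite gerBl exprn_ge0.
have := telescope_sumr (fun k => - z ^+ k) (ltnW mn); rewrite opprK addrC => <-.
by rewrite mulr_suml; apply: eq_bigr => k _; rewrite exprSr; ring.
Qed.

Definition fails_between (R : realFieldType) (Vbar lambda0 delta G : R)
    (K : {fset site}) (m n : nat) (x : site) : {set {ffun K -> bool}} :=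
  [set w | has (fun rho => w \in center_fails Vbar lambda0 delta G K x rho)
               (iota m (n - m))].

Lemma pr_fails_between (R : realFieldType) (Vbar lambda0 delta G : R)
    (K : {fset site}) (m n : nat) (x : site) :
  (512 <= m)%N -> 2 <= Vbar -> 0 <= lambda0 <= 8 ->
  1 + (4 * n)%:R * (4 * Vbar + 4) <= G ->
  0 <= delta -> (forall q, (q <= 20 * n)%N -> delta <= G ^- q) ->
  (forall c, dist1 x c <= (n.*2)%:Z -> c \in K) ->
  pr R (fails_between Vbar lambda0 delta G K m n x) <= 10 * (9 / 10) ^+ m.
Proof.
move=> m5 V2 l08 G1 d0 dG xK.
have one rho : (m <= rho < n)%N ->
    pr R (center_fails Vbar lambda0 delta G K x rho) <= (9 / 10) ^+ rho.
  move=> /andP[mr rn]; apply: pr_center_fails => //.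
  - exact: leq_trans mr.
  - by apply: le_trans G1; rewrite lerD2l ler_wpM2r ?ler_nat ?leq_pmul2l ?(ltnW rn)//; lra.
  - by move=> q qr; apply: dG; apply: leq_trans qr _; rewrite leq_pmul2l// ltnW.
  - move=> c cx; apply: xK; apply: le_trans cx _.
    by rewrite lez_nat leq_double ltnW.
apply: le_trans (_ : \sum_(k < n - m)
   pr R (center_fails Vbar lambda0 delta G K x (m + k)) <= _).
  apply: pr_bigcup => w; rewrite inE => /hasP[rho]; rewrite mem_iota => /andP[mr rn] wr.
  have k0 : (rho - m < n - m)%N by move: mr rn; clear; nat_lia.
  by exists (Ordinal k0) => //=; rewrite subnKC.
apply: le_trans (_ : \sum_(k < n - m) (9 / 10) ^+ (m + k) <= _).
  by apply: ler_sum => k _; apply: one; have := ltn_ord k; clear; nat_lia.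
have -> : \sum_(k < n - m) (9 / 10) ^+ (m + k) = \sum_(m <= k < n) (9 / 10) ^+ k :> R.
  by rewrite -[m in RHS]add0n big_addn big_mkord; apply: eq_bigr => k _; rewrite addnC.
have z01 : 0 <= (9 / 10 : R) < 1 by apply/andP; split; lra.
apply: le_trans (geometric_tail m n z01) _.
have -> : 1 - 9 / 10 = 10^-1 :> R by field.
by rewrite invrK mulrC.
Qed.

(** Blocks of [r] by [r] centres with period [8 * r] are separated enough for the
    l1-balls of radius [2 * r] around different blocks to be disjoint. *)
Definition block_site (a0 : site) (r : nat) (j1 j2 i1 i2 : nat) : site :=
  (a0.1 + (8 * r * j1 + i1)%N%:Z, a0.2 + (8 * r * j2 + i2)%N%:Z).

Section Blocks.
Context (R : realFieldType) (Vbar lambda0 delta G : R) (K : {fset site})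
  (a0 : site) (r J N : nat).

Let block := ('I_J * 'I_J)%type.
Let cell := ('I_r * 'I_r)%type.
Let pt (j : block) (i : cell) := block_site a0 r j.1 j.2 i.1 i.2.

Definition block_fails (j : block) : {set {ffun K -> bool}} :=
  [set w | (#|{: cell}| <= 2 * #|[set i : cell |
     w \in fails_between Vbar lambda0 delta G K 512 r (pt j i)]|)%N].

(** Either half of the blocks fail, or some centre fails at a radius between [r] and [N]. *)
Definition config_fails : {set {ffun K -> bool}} :=
  [set w | (#|{: block}| <= 2 * #|[set j | w \in block_fails j]|)%N] :|:
  [set w | [exists j, exists i, w \in fails_between Vbar lambda0 delta G K r N (pt j i)]].

Lemma pr_config_fails :
  (512 <= r <= N)%N -> 2 <= Vbar -> 0 <= lambda0 <= 8 ->
  1 + (4 * N)%:R * (4 * Vbar + 4) <= G ->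
  0 <= delta -> (forall q, (q <= 20 * N)%N -> delta <= G ^- q) ->
  (forall j i c, dist1 (pt j i) c <= (N.*2)%:Z -> c \in K) ->
  pr R config_fails <= 4 * 2 ^- (J ^ 2) + 10 * (J * r)%:R ^+ 2 * (9 / 10) ^+ r.
Proof.
move=> /andP[r5 rN] V2 l08 G1 d0 dG ptK.
apply: le_trans (prU _ _ _) _; apply: lerD.
  have cardB : #|{: block}| = (J ^ 2)%N by rewrite card_prod !card_ord mulnn.
  have cardC : (0 < #|{: cell}|)%N.
    by rewrite card_prod !card_ord muln_gt0 andbb; apply: leq_trans r5.
  have G1r : 1 + (4 * r)%:R * (4 * Vbar + 4) <= G.
    by apply: le_trans G1; rewrite lerD2l ler_wpM2r ?ler_nat ?leq_pmul2l//; lra.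
  have p16 j : pr R (block_fails j) <= 16^-1.
    apply: le_trans (pr_most_fail cardC (p := 10 * (9 / 10) ^+ 512) _) _.
      move=> i; apply: pr_fails_between => //.
      - by move=> q qr; apply: dG; apply: leq_trans qr _; rewrite leq_pmul2l.
      - move=> c cx; apply: (ptK j i); apply: le_trans cx _.
        by rewrite lez_nat leq_double.
    have z7 : (9 / 10) ^+ 7 <= 2^-1 :> R by rewrite !exprS expr0; lra.
    have -> : 512%N = (7 * 9 + 449)%N by [].
    rewrite exprD exprM.
    have h1 : ((9 / 10) ^+ 7) ^+ 9 <= (2^-1) ^+ 9 :> R by apply: exp_mono => //; rewrite exprn_ge0//; lra.
    have h2 : (9 / 10) ^+ 449 <= 1 :> R by apply: exprn_ile1; lra.
    have h3 : 0 <= ((9 / 10) ^+ 7) ^+ 9 :> R by rewrite exprn_ge0// exprn_ge0//; lra.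
    have h4 : 0 <= (9 / 10) ^+ 449 :> R by rewrite exprn_ge0//; lra.
    have h5 : (2^-1) ^+ 9 <= 320^-1 :> R by rewrite !exprS expr0; lra.
    move: h1 h2 h3 h4; set x := (_ ^+ 7) ^+ 9; set y := _ ^+ 449 => h1 h2 h3 h4.
    have : x * y <= 320^-1 * 1 by apply: ler_pM => //; lra.
    lra.
  pose S (j : block) := [set y : K | [exists i : cell, dist1 (pt j i) (val y) <= (r.*2)%:Z]].
  have dep j : depends_on (S j) (block_fails j).
    move=> w w' ww'; rewrite !inE => h; apply: leq_trans h _; rewrite leq_pmul2l//.
    apply/subset_leq_card/fintype.subsetP => i; rewrite !inE => /hasP[rho rI wf].
    apply/hasP; exists rho => //; move: rI; rewrite mem_iota => /andP[mr rn].
    apply: center_fails_local wf => // y yx; apply: ww'; rewrite inE.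
    by apply/existsP; exists i; apply: le_trans yx _; rewrite lez_nat leq_double; nat_lia.
  have dis (j l : block) : j != l -> [disjoint S j & S l].
    move=> jl; rewrite -setI_eq0; apply/eqP/setP => y; rewrite !inE.
    apply/negP => /andP[/existsP[i h1] /existsP[i' h2]].
    case/negP: jl; apply/eqP.
    move: j l i i' h1 h2 => [[j1 hj1] [j2 hj2]] [[l1 hl1] [l2 hl2]]
      [[i1 hi1] [i2 hi2]] [[k1 hk1] [k2 hk2]].
    rewrite /pt !dist1E /block_site /= => h1 h2.
    have [e1 e2] : j1 = l1 /\ j2 = l2.
      clear -h1 h2 hi1 hi2 hk1 hk2 r5; move: (val y) h1 h2 => [y1 y2] /= h1 h2.
      by split; nia.
    by subst l1 l2; congr (_, _); apply/val_inj.
  have p01 : 0 <= (16^-1 : R) <= 1 by apply/andP; split; lra.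
  apply: le_trans (pr_many_fail dep dis p01 p16) _.
  rewrite cardB; set n := (J ^ 2)%N.
  have -> : 16^-1 = (4^-1) ^+ 2 :> R by rewrite expr2; field.
  rewrite -exprM; have [b nE] : exists b : bool, n = (2 * n./2 + b)%N.
    by exists (odd n); rewrite mul2n addnC odd_double_half.
  move: nE; set m := (2 * n./2)%N => ->.
  rewrite [X in X * _ <= _]exprD -[2 ^- _]exprVn [X in _ <= _ * X]exprD.
  have -> : (4^-1 : R) = 2^-1 * 2^-1 by field.
  rewrite exprMn.
  have e1 : 2 ^+ m * (2^-1) ^+ m = 1 :> R by rewrite exprVn divff// expf_neq0.
  have p0 : 0 <= (2^-1 : R) ^+ m by rewrite exprn_ge0.
  have -> : 2 ^+ m * 2 ^+ b * ((2^-1) ^+ m * (2^-1) ^+ m) =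
     2 ^+ b * (2^-1) ^+ m * (2 ^+ m * (2^-1) ^+ m) :> R by ring.
  rewrite e1 mulr1 mulrCA [X in X <= _]mulrC ler_wpM2l//.
  by case: b; rewrite ?expr0 ?expr1; lra.
apply: le_trans (_ : \sum_(z : block * cell)
    pr R (fails_between Vbar lambda0 delta G K r N (pt z.1 z.2)) <= _).
  by apply: pr_bigcup => w; rewrite inE => /existsP[j /existsP[i wf]]; exists (j, i).
apply: le_trans (_ : \sum_(z : block * cell) 10 * (9 / 10) ^+ r <= _).
  apply: ler_sum => -[j i] _; apply: pr_fails_between => // c; exact: ptK.
rewrite sumr_const -[X in X <= _]mulr_natl !card_prod !card_ord.
rewrite !natrM; set A := _ ^+ r; lra.
Qed.

(** At least half of the blocks do not fail, and at least half of the centres of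
    such a block do not. *)
Lemma many_good_centers w : w \notin config_fails ->
  (J ^ 2 * r ^ 2 <= 4 * #|[set z : block * cell | [forall rho : 'I_N,
     (512 <= rho)%N ==> (w \notin center_fails Vbar lambda0 delta G K (pt z.1 z.2) rho)]]|)%N.
Proof.
rewrite 2!inE negb_or !inE -ltnNge => /andP[few none].
set A := [set z | _].
pose good := [set j | w \notin block_fails j].
have goodJ : (J ^ 2 <= 2 * #|good|)%N.
  move: few; have := cardsC [set j | w \in block_fails j].
  have -> : ~: [set j | w \in block_fails j] = good.
    by apply/setP => j; rewrite !inE.
  by rewrite card_prod !card_ord mulnn; nat_lia.
have goodC j : j \in good -> (r ^ 2 <= 2 * #|[set i : cell | (j, i) \in A]|)%N.
  rewrite inE inE -ltnNge => fewC; pose F := [set i : cell |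
     w \in fails_between Vbar lambda0 delta G K 512 r (pt j i)].
  have sub : ~: F \subset [set i : cell | (j, i) \in A].
    apply/fintype.subsetP => i; rewrite !inE => /hasPn nF.
    apply/forallP => rho; apply/implyP => rho5 /=; apply/negP => wf.
    have [rr|rr] := ltnP rho r.
      have /nF : (rho : nat) \in iota 512 (r - 512).
        by rewrite mem_iota rho5 /=; move: rho5 rr; clear; nat_lia.
      by rewrite wf.
    case/negP: none; apply/existsP; exists j; apply/existsP; exists i; rewrite inE.
    apply/hasP; exists (rho : nat) => //; rewrite mem_iota rr /=.
    by have := ltn_ord rho; move: rr; clear; nat_lia.
  have := subset_leq_card sub; have := cardsC F; move: fewC; rewrite -/F.
  by rewrite card_prod !card_ord mulnn; nat_lia.
have sumA : (\sum_(j in good) #|[set i : cell | (j, i) \in A]| <= #|A|)%N.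
  under eq_bigr do rewrite -sum1_card.
  rewrite pair_big_dep -[X in (_ <= X)%N]sum1_card.
  rewrite [X in (_ <= X)%N](bigID (fun z : block * cell => z.1 \in good)) /=.
  apply: leq_trans (leq_addr _ _).
  rewrite leq_eqVlt; apply/orP; left; apply/eqP; apply: eq_bigl => -[j i] /=.
  by rewrite !inE andbC.
have : (\sum_(j in good) r ^ 2 <= \sum_(j in good) 2 * #|[set i : cell | (j, i) \in A]|)%N.
  exact: leq_sum.
rewrite sum_nat_const -big_distrr /=.
move: sumA goodJ; set s := \sum_(_ in _) _; move: (#|A|) (#|good|) => b g h1 h2 h3.
by nia.
Qed.

End Blocks.

(** * A centre with controlled growth *)

(** The choice of [r] of order [k ^ (2 / 3)], and of [J] of order [k / r]. *)
Lemma choose_scale (c k : nat) : (0 < c)%N -> (c ^ 3 <= k)%N ->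
  exists r J, [/\ (r ^ 3 <= k ^ 2)%N, (k ^ 2 < r.+1 ^ 3)%N, (c * (r * J) <= k)%N &
    (k < 2 * c * (r * J))%N].
Proof.
move=> c0 ck.
have k0 : (0 < k)%N by apply: leq_trans ck; rewrite expn_gt0 c0.
have exr : exists r, (r ^ 3 <= k ^ 2)%N by exists 0%N; rewrite exp0n.
have ubr r : (r ^ 3 <= k ^ 2)%N -> (r <= k ^ 2)%N.
  by move=> rk; apply: leq_trans rk; case: r => // r; rewrite -{1}[r.+1]expn1 leq_pexp2l.
case: (ex_maxnP exr ubr) => r rk rmax.
have rk' : (k ^ 2 < r.+1 ^ 3)%N.
  by rewrite ltnNge; apply/negP => /rmax; rewrite ltnn.
have r0 : (0 < r)%N.
  by apply: rmax; rewrite exp1n expn_gt0 k0.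
have crk : (c * r <= k)%N.
  rewrite -(leq_exp2r _ _ (isT : (0 < 3)%N)) expnMn.
  by apply: leq_trans (leq_mul ck rk) _; rewrite -expnS.
have cr0 : (0 < c * r)%N by rewrite muln_gt0 c0.
exists r, (k %/ (c * r))%N; split => //.
  by rewrite mulnA mulnC leq_divM.
have J0 : (0 < k %/ (c * r))%N by rewrite divn_gt0.
rewrite -!mulnA [(c * _)%N]mulnA.
apply: leq_trans (ltn_ceil k cr0) _.
by move: J0; set J := (_ %/ _)%N; set d := (c * r)%N; clearbody J d; nia.
Qed.

Definition box_seq (a0 : site) (k : nat) : seq site :=
  [seq (a0.1 + i%:Z - k%:Z, a0.2 + j%:Z - k%:Z) | i <- iota 0 k.*2.+1, j <- iota 0 k.*2.+1].

Definition box_fset (a0 : site) (k : nat) : {fset site} := [fset c in box_seq a0 k]%fset.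

Lemma in_box_fset a0 k c : (c \in box_fset a0 k) = (norm_inf (a0 - c) <= k%:Z).
Proof.
have -> : (c \in box_fset a0 k) = (c \in box_seq a0 k) by rewrite in_fset.
apply/allpairsP/idP => [[[i j] [hi hj ->]]|].
  move: hi hj; rewrite !mem_iota /norm_inf ge_max [_.1]/= [_.2]/= => hi hj.
  by apply/andP; split; rewrite /=; lia.
rewrite /norm_inf ge_max => /andP[h1 h2]; rewrite /= in h1 h2.
exists (absz (c.1 - a0.1 + k%:Z), absz (c.2 - a0.2 + k%:Z)).
rewrite !mem_iota; split; [rewrite [_.1]/=; lia|rewrite [_.2]/=; lia|].
by apply: site_ext => /=; lia.
Qed.

Lemma block_site_inj a0 r j1 j2 i1 i2 l1 l2 m1 m2 :
  (i1 < r)%N -> (i2 < r)%N -> (m1 < r)%N -> (m2 < r)%N ->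
  block_site a0 r j1 j2 i1 i2 = block_site a0 r l1 l2 m1 m2 ->
  [/\ j1 = l1, j2 = l2, i1 = m1 & i2 = m2].
Proof.
move=> hi1 hi2 hm1 hm2 [/addrI[h1] /addrI[h2]].
have key j i l m : (i < r)%N -> (m < r)%N -> (8 * r * j + i = 8 * r * l + m)%N ->
    j = l /\ i = m.
  move=> hi hm h; have jl : j = l by nia.
  by split => //; move: h; rewrite jl => /addnI.
have [] := key _ _ _ _ hi1 hm1 h1; have [] := key _ _ _ _ hi2 hm2 h2.
by move=> -> -> -> ->.
Qed.

Lemma block_offset r J k j i :
  (400 * (r * J) <= k)%N -> (j < J)%N -> (i < r)%N -> (8 * r * j + i <= k %/ 50)%N.
Proof.
move=> Jk hj hi.
have key : (8 * r * j + i <= 8 * (r * J))%N.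
  have : (r * j.+1 <= r * J)%N by rewrite leq_mul2l hj orbT.
  by rewrite mulnS -mulnA; move: (r * j)%N (r * J)%N => p q; lia.
have e : 400%N = (8 * 50)%N by [].
have : (0 < 50)%N by [].
move: Jk; rewrite e; move: 50%N => q Jk q0.
rewrite leq_divRL//; apply: leq_trans Jk.
by rewrite [(8 * q * _)%N]mulnAC leq_mul2r key orbT.
Qed.

Lemma block_site_near a0 r J k j1 j2 i1 i2 c n :
  (400 * (r * J) <= k)%N -> (j1 < J)%N -> (j2 < J)%N -> (i1 < r)%N -> (i2 < r)%N ->
  norm_inf (a0 - c) <= n%:Z ->
  dist1 (block_site a0 r j1 j2 i1 i2) c <= (n + n)%N%:Z + ((k %/ 50).*2)%:Z.
Proof.
move=> Jk hj1 hj2 hi1 hi2; rewrite dist1E /norm_inf /block_site /= ge_max => /andP[h1 h2].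
have off := block_offset Jk.
have o1 := off _ _ hj1 hi1; have o2 := off _ _ hj2 hi2.
move: o1 o2 h1 h2; move: (8 * r * j1 + i1)%N (8 * r * j2 + i2)%N (k %/ 50)%N => s1 s2 q.
by clear; lia.
Qed.

Lemma block_site_ball_box a0 r J k j1 j2 i1 i2 c n :
  (400 * (r * J) <= k)%N -> (j1 < J)%N -> (j2 < J)%N -> (i1 < r)%N -> (i2 < r)%N ->
  dist1 (block_site a0 r j1 j2 i1 i2) c <= n%:Z ->
  norm_inf (a0 - c) <= (n + k %/ 50)%N%:Z.
Proof.
move=> Jk hj1 hj2 hi1 hi2; rewrite dist1E /norm_inf /block_site /= ge_max => h.
have off := block_offset Jk.
have o1 := off _ _ hj1 hi1; have o2 := off _ _ hj2 hi2.
move: o1 o2 h; move: (8 * r * j1 + i1)%N (8 * r * j2 + i2)%N (k %/ 50)%N => s1 s2 q.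
by clear => *; apply/andP; split; lia.
Qed.

(** At least a quarter of the centres have no failure at any scale, while by
    [vitali] fewer than that see too many large sites at some scale. Around a
    centre with neither defect, [tower_bound] applies up to a ball that
    contains the small box. *)
Lemma good_config_bound (R : realFieldType) (Vbar lambda0 lambda delta G : R)
    (a0 : site) (k r J : nat) (w : {ffun box_fset a0 k -> bool})
    (u : site -> R) (Bd : seq site) :
  let N := (k %/ 10)%N in
  2 <= Vbar -> 0 <= lambda0 <= 8 -> (512 <= k %/ 10)%N -> (512 <= r)%N ->
  (400 * (r * J) <= k)%N ->
  1 + (4 * N)%:R * (4 * Vbar + 4) <= G ->
  `|lambda - lambda0| <= delta -> delta <= 2^-1 ->
  w \notin config_fails Vbar lambda0 delta G (box_fset a0 k) a0 r J N ->
  (forall c, norm_inf (a0 - c) <= k%:Z -> lattice_solves (potential Vbar w) lambda u c) ->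
  (forall c, norm_inf (a0 - c) <= k%:Z -> 1 <= `|u c| -> c \in Bd) ->
  (4 * (81 * 512 ^ 2 * size Bd) < J ^ 2 * r ^ 2)%N ->
  forall c, norm_inf (a0 - c) <= (k %/ 100)%:Z -> `|u c| <= G ^+ (40 * 256 * N.*2).
Proof.
move=> N V2 l08 k5 r5 Jk G1 lamd del wgood sol bad few c cnear.
have N5 : (512 <= N)%N := k5.
have G1' : 1 <= G.
  by apply: le_trans G1; rewrite lerDl; apply: mulr_ge0; [exact: ler0n|clear -V2; lra].
have many := many_good_centers wgood.
set A := [set z | _] in many.
pose pt (z : ('I_J * 'I_J) * ('I_r * 'I_r)) := block_site a0 r z.1.1 z.1.2 z.2.1 z.2.2.
have ptinj : injective pt.
  move=> [[j1 j2] [i1 i2]] [[l1 l2] [m1 m2]].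
  move=> /(block_site_inj (ltn_ord _) (ltn_ord _) (ltn_ord _) (ltn_ord _)) /=.
  by move=> [/val_inj-> /val_inj-> /val_inj-> /val_inj->].
have ball_box z c' : dist1 (pt z) c' <= (N.*2)%:Z -> norm_inf (a0 - c') <= k%:Z.
  move=> h; have := block_site_ball_box Jk (ltn_ord _) (ltn_ord _) (ltn_ord _) (ltn_ord _) h.
  move=> h'; apply: le_trans h' _; rewrite lez_nat /N; clear; nat_lia.
have [z zA light] : exists2 z, z \in A & forall rho, (512 <= rho <= N)%N ->
    (512 ^ 2 * count (in_ball (pt z) rho.*2) Bd < rho ^ 2)%N.
  apply: contrapT => nex; move: few; apply/negP; rewrite -leqNgt.
  apply: leq_trans many _; rewrite leq_mul2l; apply/orP; right.
  have /choice[rad Hrad] : forall x : site, exists rho, x \in [seq pt z | z <- enum A] ->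
      (0 < rho)%N /\ (rho ^ 2 <= 512 ^ 2 * count (in_ball x rho.*2) Bd)%N.
    move=> x; have [/mapP[z]|] := boolP (x \in _); last by exists 0%N.
    rewrite mem_enum => zA ->.
    apply: contrapT => nrho; apply: nex; exists z => // rho /andP[rho5 rhoN].
    rewrite ltnNge; apply/negP => h; apply: nrho; exists rho => _; split => //.
    exact: leq_trans rho5.
  have := @vitali rad (512 ^ 2) [seq pt z | z <- enum A] Bd.
  rewrite size_map -cardE => -> //.
  by rewrite map_inj_uniq ?enum_uniq.
have zgood rho : (512 <= rho < N)%N ->
    w \notin center_fails Vbar lambda0 delta G (box_fset a0 k) (pt z) rho.
  move=> /andP[h1 h2]; move: zA; rewrite inE => /forallP/(_ (Ordinal h2))/implyP.
  exact.
have [rho /andP[Nr rN] Hr] := tower_bound N5 V2 l08 G1 lamd del zgood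
  (fun c hc => sol c (ball_box z c hc)) (fun c hc => bad c (ball_box z c hc)) light.
apply: le_trans (Hr c _) _.
  apply: le_trans (block_site_near Jk (ltn_ord _) (ltn_ord _) (ltn_ord _) (ltn_ord _) cnear) _.
  by move: Nr k5; rewrite /N; clear; int_lia.
by rewrite ler_weXn2l// leq_mul2l rN orbT.
Qed.

(** * Asymptotics of the failure probability *)

Lemma bernoulli_ineq (R : realFieldType) (x : R) n : 0 <= x -> 1 + n%:R * x <= (1 + x) ^+ n.
Proof.
move=> x0; elim: n => [|n IHn]; first by rewrite mul0r addr0 expr0.
rewrite exprS -natr1; have : 0 <= n%:R :> R by [].
have : (1 + x) * (1 + n%:R * x) <= (1 + x) * (1 + x) ^+ n by rewrite ler_pM2l//; lra.
by nra.
Qed.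

(** The blocks contribute [2 ^- (J ^ 2)] and the large radii [(9 / 10) ^ r], up to
    powers of [r]; both are exponentially small in [r]. *)
Lemma failure_asymptotics (R : realType) (eps : R) (r J : nat) :
  0 < eps -> eps <= 10 ^- 8 -> 20 * 50 ^+ 4 <= r%:R :> R ->
  r%:R <= 800 ^+ 2 * (J ^ 2)%:R :> R -> (J * r)%:R ^+ 2 <= r.+1%:R ^+ 3 :> R ->
  4 * 2 ^- (J ^ 2) + 10 * (J * r)%:R ^+ 2 * (9 / 10) ^+ r <= expR (- (eps * (4 * r%:R))).
Proof.
move=> eps0 eps1 rbig; move: (J ^ 2)%N => n rn Jr.
set E := expR _.
have eps2 : eps * 10 ^+ 8 <= 1 by rewrite -ler_pdivlMr ?exprn_gt0// mul1r.
have epsr : eps * r%:R * 10 ^+ 8 <= r%:R.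
  by rewrite mulrAC -[X in _ <= X]mul1r ler_wpM2r.
have n6 : (6 <= n)%N.
  rewrite -(ler_nat R); move: rbig rn; rewrite !exprS expr0; lra.
have En : (3 / 4) ^+ n <= E.
  have q : 3 / 4 <= expR (- 4^-1) :> R by have := @expR_ge1Dx R (- 4^-1); lra.
  have h : expR (n%:R * - 4^-1) <= E.
    rewrite ler_expR; move: epsr rn; set t := eps * r%:R.
    rewrite [eps * _]mulrCA -/t !exprS expr0; lra.
  apply: le_trans h; rewrite expRM_natl; apply: exp_mono => //; lra.
have Er : (99 / 100) ^+ r <= E.
  have q : 99 / 100 <= expR (- 100^-1) :> R by have := @expR_ge1Dx R (- 100^-1); lra.
  have h : expR (r%:R * - 100^-1) <= E.
    rewrite ler_expR; move: epsr; set t := eps * r%:R.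
    rewrite [eps * _]mulrCA -/t !exprS expr0; have : 0 <= r%:R :> R by []. lra.
  apply: le_trans h; rewrite expRM_natl; apply: exp_mono => //; lra.
have first_half : 8 * 2 ^- n <= E.
  apply: le_trans En; rewrite ler_pdivrMr ?exprn_gt0// -exprMn.
  have -> : (3 / 4 * 2 : R) = 3 / 2 by field.
  apply: le_trans (_ : (3 / 2) ^+ 6 <= _); first by rewrite !exprS expr0; lra.
  by rewrite ler_weXn2l//; lra.
have second_half : 20 * (J * r)%:R ^+ 2 * (9 / 10) ^+ r <= E.
  apply: le_trans Er.
  have -> : (99 / 100) ^+ r = (11 / 10) ^+ r * (9 / 10) ^+ r :> R.
    by rewrite -exprMn; congr (_ ^+ _); field.
  have z0 : 0 <= 9 / 10 :> R by lra.
  rewrite ler_wpM2r ?exprn_ge0//.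
  have b1 : r.+1%:R / 50 <= (1 + 50^-1) ^+ r :> R.
    have p : 0 <= 50^-1 :> R by lra.
    have := bernoulli_ineq r p; rewrite -[r.+1%:R]natr1; lra.
  have b2 : ((1 + 50^-1) ^+ r) ^+ 4 <= (11 / 10) ^+ r :> R.
    rewrite -exprM mulnC exprM; apply: exp_mono; first by rewrite exprn_ge0//; lra.
    by rewrite !exprS expr0; lra.
  apply: le_trans b2.
  apply: le_trans (_ : (r.+1%:R / 50) ^+ 4 <= _); last first.
    by apply: exp_mono => //; rewrite divr_ge0.
  apply: le_trans (_ : 20 * r.+1%:R ^+ 3 <= _); first by rewrite ler_pM2l.
  have r1 : 20 * 50 ^+ 4 <= r.+1%:R :> R by apply: le_trans rbig _; rewrite ler_nat.
  rewrite exprMn exprVn ler_pdivlMr ?exprn_gt0//.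
  have -> : 20 * r.+1%:R ^+ 3 * 50 ^+ 4 = r.+1%:R ^+ 3 * (20 * 50 ^+ 4) :> R by ring.
  by rewrite [r.+1%:R ^+ 4]exprSr ler_wpM2l// exprn_ge0.
move: first_half second_half; set x := 2 ^- n; set y := _ ^+ r.
set z := _ ^+ 2; rewrite -mulrA -[10 * z * y]mulrA.
by move: (z * y) => t; lra.
Qed.

Lemma pow_two_thirds (R : realType) (L c : R) : 0 <= L -> 0 <= c -> L ^+ 2 <= c ^+ 3 ->
  L `^ (2 / 3) <= c.
Proof.
move=> L0 c0 Lc.
have -> : L `^ (2 / 3) = (L ^+ 2) `^ (3^-1).
  by rewrite -powR_mulrn// -powRrM; congr (_ `^ _); field.
have -> : c = (c ^+ 3) `^ (3^-1).
  rewrite -[c ^+ 3]powR_mulrn// -powRrM.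
  have -> : 3%:R * 3^-1 = 1 :> R by field.
  by rewrite powRr1.
by apply: ge0_ler_powR => //; rewrite ?nnegrE ?exprn_ge0//; lra.
Qed.

(** * The law of the potential on a box *)

Lemma neighbor_sum (R : realType) (u : site -> R) (a : site) :
  \sum_(b \in [set b | neighbor a b]%classic) u b =
  u (a + (1, 0)) + u (a - (1, 0)) + u (a + (0, 1)) + u (a - (0, 1)).
Proof.
pose s : seq site := [:: a + (1, 0); a - (1, 0); a + (0, 1); a - (0, 1)].
have sE : [set b | neighbor a b]%classic = [set` s]%classic.
  apply/seteqP; split => b /=; rewrite /neighbor /norm_one !inE.
    move=> h; have : (a.1 - b.1 = -1 /\ a.2 = b.2) \/ (a.1 - b.1 = 1 /\ a.2 = b.2) \/
         (a.1 = b.1 /\ a.2 - b.2 = -1) \/ (a.1 = b.1 /\ a.2 - b.2 = 1).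
      by move: h => /=; lia.
    case=> [[h1 h2]|[[h1 h2]|[[h1 h2]|[h1 h2]]]].
    - by have -> : b = a + (1, 0); [apply: site_ext => /=; lia|rewrite eqxx].
    - by have -> : b = a - (1, 0); [apply: site_ext => /=; lia|rewrite eqxx orbT].
    - by have -> : b = a + (0, 1); [apply: site_ext => /=; lia|rewrite eqxx !orbT].
    - by have -> : b = a - (0, 1); [apply: site_ext => /=; lia|rewrite eqxx !orbT].
  by case/or4P => /eqP-> /=; lia.
have us : uniq s.
  pose ds : seq site := [:: (1, 0); - (1, 0); (0, 1); - (0, 1)].
  have -> : s = map (+%R a) ds by [].
  by rewrite map_inj_uniq//; exact: addrI.
rewrite sE -fsbig_seq// /s !big_cons big_nil /=; ring.
Qed.

Lemma hamiltonian_lattice (R : realType) (v u : site -> R) (lambda : R) (a : site) :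
  hamiltonian v u a = lambda * u a -> lattice_solves v lambda u a.
Proof.
rewrite /hamiltonian /laplacian neighbor_sum /lattice_solves.
set S := _ + _ + _ + _ => h.
have -> : S = lambda * u a - (- (- 4 * u a + S) + v a * u a) + (4 + v a - lambda) * u a.
  by ring.
by rewrite h subrr add0r.
Qed.

Definition cylinder d (T : measurableType d) (R : realType) (P : probability T R)
    (V : site -> {RV P >-> R}) (Vbar : R) (K : {fset site}) (w : {ffun K -> bool}) : set T :=
  (\bigcap_(c in [set` K]) (V c @^-1` [set potential Vbar w c]))%classic.

Lemma potential_in (R : realType) (Vbar : R) (K : {fset site}) (w : {ffun K -> bool}) (y : K) :
  potential Vbar w (val y) = if w y then Vbar else 0.
Proof. by rewrite /potential valK. Qed.

Lemma measurable_cylinder d (T : measurableType d) (R : realType) (P : probability T R)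
    (V : site -> {RV P >-> R}) (Vbar : R) (K : {fset site}) (w : {ffun K -> bool}) :
  measurable (cylinder V Vbar w).
Proof.
by apply: fin_bigcap_measurable => // c _; exact: measurable_funPTI.
Qed.

(** Each configuration of a finite set of sites has probability [2 ^- #|` K|], so the
    uniform measure computes the probabilities of events in the box. *)
Lemma prob_cylinder d (T : measurableType d) (R : realType) (P : probability T R)
    (V : site -> {RV P >-> R}) (Vbar : R) (K : {fset site}) (w : {ffun K -> bool}) :
  bernoulli_potential Vbar V -> P (cylinder V Vbar w) = (2 ^- #|` K|)%:E.
Proof.
move=> [ind law]; rewrite /cylinder.
rewrite (ind (enum_fset K) (fun c => [set potential Vbar w c]%classic)) ?fset_uniq//.
elim: (enum_fset K) => [|c s IHs]; first by rewrite big_nil expr0 invr1.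
rewrite big_cons IHs exprS invfM EFinM; congr (_ * _)%E.
have [l0 lV] := law c.
by rewrite /potential; case: insub => [y|//]; case: (w y).
Qed.

Lemma trivIset_cylinder d (T : measurableType d) (R : realType) (P : probability T R)
    (V : site -> {RV P >-> R}) (Vbar : R) (K : {fset site}) (D : set {ffun K -> bool}) :
  Vbar != 0 -> trivIset D (fun w => cylinder V Vbar w).
Proof.
move=> V0 w w' _ _ [t [tw tw']]; apply/ffunP => y.
have := tw (val y) (valP y); have := tw' (val y) (valP y).
rewrite /= !potential_in => -> /eqP.
by case: (w y); case: (w' y) => //; rewrite ?(negbTE V0)// eq_sym (negbTE V0).
Qed.

Lemma prob_good_configs d (T : measurableType d) (R : realType) (P : probability T R)
    (V : site -> {RV P >-> R}) (Vbar : R) (K : {fset site}) (E : {set {ffun K -> bool}}) :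
  Vbar != 0 -> bernoulli_potential Vbar V ->
  P (\bigcup_(w in [set` ~: E]) cylinder V Vbar w)%classic = (1 - pr R E)%:E.
Proof.
move=> V0 bern; rewrite measure_fin_bigcup//; last 2 first.
- exact: trivIset_cylinder.
- by move=> w _; exact: measurable_cylinder.
transitivity (\sum_(w in ~: E) (2 ^- #|` K| : R)%:E)%E.
  have -> : [set` ~: E]%classic = [set` enum (~: E)]%classic.
    by apply/seteqP; split => w /=; rewrite mem_enum.
  rewrite -fsbig_seq ?enum_uniq// big_enum; apply: eq_bigr => w _.
  exact: prob_cylinder.
by rewrite sumEFin sumr_const -prC /pr mulr_natl cardfE.
Qed.

(** * The unique continuation event *)

Local Open Scope classical_set_scope.

Lemma lattice_solves_scale (R : realType) (V : site -> R) (lambda s : R) (u : site -> R) c :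
  lattice_solves V lambda u c -> lattice_solves V lambda (fun c => u c / s) c.
Proof. by rewrite /lattice_solves -!mulrDl => ->; rewrite mulrA. Qed.

Lemma lattice_solves_eq (R : realType) (V V' : site -> R) (lambda : R) (u : site -> R) c :
  V c = V' c -> lattice_solves V lambda u c -> lattice_solves V' lambda u c.
Proof. by rewrite /lattice_solves => ->. Qed.

Lemma size_box_seq a0 k : size (box_seq a0 k) = (k.*2.+1 ^ 2)%N.
Proof. by rewrite size_allpairs !size_iota mulnn. Qed.

Lemma uniq_box_seq a0 k : uniq (box_seq a0 k).
Proof.
apply: allpairs_uniq; rewrite ?iota_uniq// => -[i j] [i' j'] _ _ [].
by move=> h1 h2; congr (_, _); lia.
Qed.

(** If the large sites were few, dividing [u] by [delta] times its norm on the small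
    box would give a function to which [good_config_bound] applies. The
    resulting bound on the small box is below [delta ^-1], the norm of this
    function there. *)
Lemma good_event (R : realType) (eps delta Vbar lambda0 l G : R) (a : site)
    (k r J : nat) (v : site -> R) (w : {ffun box_fset a k -> bool}) :
  let N := (k %/ 10)%N in
  let L := 2 * k%:R in
  0 < eps -> eps <= 10 ^- 8 ->
  (forall c, box l a c <-> norm_inf (a - c) <= k%:Z) ->
  (forall c, box (l / 100) a c -> norm_inf (a - c) <= (k %/ 100)%:Z) ->
  2 <= Vbar -> 0 <= lambda0 <= 8 -> (512 <= k %/ 10)%N -> (512 <= r)%N ->
  (400 * (r * J) <= k)%N -> (k < 2 * 400 * (r * J))%N ->
  1 + (4 * N)%:R * (4 * Vbar + 4) <= G ->
  0 < delta -> delta <= 2^-1 -> delta * G ^+ (40 * 256 * N.*2) < 1 ->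
  w \notin config_fails Vbar lambda0 delta G (box_fset a k) a r J N ->
  (forall c, norm_inf (a - c) <= k%:Z -> v c = potential Vbar w c) ->
  forall (lambda : R) (u : site -> R), `|lambda - lambda0| <= delta ->
    (forall b, box l a b -> hamiltonian v u b = lambda * u b) ->
    eps ^+ 3 * L ^+ 2 <=
      (num_large (box l a) u (delta * linf_norm (box (l / 100) a) u))%:R.
Proof.
move=> N L eps0 eps1 boxE box100 V2 l08 k5 r5 Jk kJ G1 d0 del dG wgood vw lambda u lamd Hu.
rewrite leNgt; apply/negP => few.
set m := linf_norm _ _ in few.
have e3 : eps ^+ 3 * 10 ^+ 24 <= 1.
  have -> : (24 = 8 * 3)%N by [].
  rewrite exprM -exprMn; apply: exprn_ile1.
    by rewrite mulr_ge0 ?exprn_ge0// ltW.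
  by rewrite -ler_pdivlMr ?exprn_gt0// mul1r.
have e30 : 0 <= eps ^+ 3 by rewrite exprn_ge0// ltW.
have boxK : box l a = [set` box_fset a k].
  by apply/seteqP; split => c /=; rewrite in_box_fset => ?; apply/boxE.
pose Bset := [set c | box l a c /\ delta * m <= `|u c|].
have Bfin : finite_set Bset.
  by apply: (@sub_finite_set _ _ (box l a)) => [c []//|]; rewrite boxK.
pose Bd : seq site := enum_fset (fset_set Bset).
have sizeBd : size Bd = num_large (box l a) u (delta * m) by [].
have inBd c : norm_inf (a - c) <= k%:Z -> delta * m <= `|u c| -> c \in Bd.
  move=> ck cu; have : c \in fset_set Bset; last by [].
  by rewrite in_fset_set//; apply/mem_set; split => //; apply/boxE.
have fewBd : (size Bd)%:R * 10 ^+ 24 < 4 * k%:R ^+ 2 :> R.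
  rewrite sizeBd; apply: lt_le_trans (_ : eps ^+ 3 * L ^+ 2 * 10 ^+ 24 <= _).
    by rewrite ltr_pM2r// exprn_gt0.
  rewrite mulrAC /L exprMn -[X in _ <= X]mul1r.
  by rewrite (_ : 2 ^+ 2 = 4)//; [rewrite ler_wpM2r// mulr_ge0// exprn_ge0|rewrite expr2; lra].
have kR : k%:R <= 800 * (r * J)%:R :> R.
  move: kJ; rewrite -(ltr_nat R) !natrM; clear; lra.
have fewN : (4 * (81 * 512 ^ 2 * size Bd) < J ^ 2 * r ^ 2)%N.
  rewrite -(ltr_nat R) !natrM -!expr2.
  have h : k%:R ^+ 2 <= (800 * (r * J)%:R) ^+ 2 :> R by apply: exp_mono.
  rewrite exprMn natrM exprMn in h.
  move: fewBd h; set s := (size Bd)%:R; set x := r%:R ^+ 2; set y := J%:R ^+ 2.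
  rewrite [y * x]mulrC; set z := x * y.
  have s0 : 0 <= s by exact: ler0n.
  set kk := k%:R ^+ 2; clearbody s z kk; rewrite !exprS !expr0; move: s0; clear.
  lra.
(* the threshold is then at most 0, and all the sites of the box count as large *)
have [m0|m0] := leP m 0.
  have sub : (size (box_seq a k) <= size Bd)%N.
    apply: uniq_leq_size (uniq_box_seq a k) _ => c cb; apply: inBd.
      by rewrite -in_box_fset in_fset.
    by apply: le_trans (normr_ge0 _); rewrite mulr_ge0_le0// ltW.
  move: sub; rewrite size_box_seq -(ler_nat R) natrX => sub.
  have h : (2 * k%:R) ^+ 2 <= k.*2.+1%:R ^+ 2 :> R.
    by apply: exp_mono; rewrite ?mulr_ge0// -natrM ler_nat mul2n.
  have s4 : (size Bd)%:R * 4 <= (size Bd)%:R * 10 ^+ 24 :> R.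
    rewrite ler_wpM2l// -[X in X <= _]expr1 (le_trans (_ : _ <= 10 ^+ 1)) ?expr1//.
      by rewrite ler_nat.
    by rewrite -[X in X <= _]expr1 ler_weXn2l// ler1n.
  have := le_lt_trans s4 fewBd; rewrite [X in _ < X]mulrC ltr_pM2r//.
  have kk0 : k%:R ^+ 2 <= (2 * k%:R) ^+ 2 :> R by apply: exp_mono => //; rewrite ler_peMl// ler1n.
  by rewrite ltNge (le_trans kk0 (le_trans h sub)).
have dm0 : 0 < delta * m by rewrite mulr_gt0.
pose u' c := u c / (delta * m).
have bound : forall c, norm_inf (a - c) <= (k %/ 100)%:Z ->
    `|u' c| <= G ^+ (40 * 256 * N.*2).
  apply: (good_config_bound V2 l08 k5 r5 Jk G1 lamd del wgood (Bd := Bd)) => //.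
    move=> c ck; apply: lattice_solves_scale.
    apply: (lattice_solves_eq (vw c ck)); apply: hamiltonian_lattice.
    by apply: Hu; apply/boxE.
  move=> c ck uc; apply: inBd => //; move: uc.
  by rewrite /u' normrM normfV (gtr0_norm dm0) ler_pdivlMr// mul1r.
have : m <= delta * G ^+ (40 * 256 * N.*2) * m.
  rewrite {1}/m /linf_norm; apply: ge_sup.
    apply: contrapT => emp; move: m0; rewrite /m /linf_norm.
    suff -> : [set `|u a0| | a0 in box (l / 100) a] = set0 by rewrite sup0 ltxx.
    by apply/seteqP; split => // x [c hc _]; apply: emp; exists `|u c|, c.
  move=> _ [c hc <-]; have := bound c (box100 c hc).
  rewrite /u' normrM normfV (gtr0_norm dm0) ler_pdivrMr// => h.
  by apply: le_trans h _; rewrite mulrA [X in X * m]mulrC.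
rewrite -[X in X <= _]mul1r ler_pM2r// => h.
by have := le_lt_trans h dG; rewrite ltxx.
Qed.

(** * Choice of the scales and conclusion *)

Lemma box_radius (R : realType) (l : R) (k : nat) (a c : site) :
  Num.floor ((l - 1) / 2) = k%:Z -> box l a c <-> norm_inf (a - c) <= k%:Z.
Proof. by move=> fl; rewrite /box /= -fl floor_ge_int. Qed.

Lemma small_box_radius (R : realType) (l : R) (k : nat) (a c : site) :
  Num.floor ((l - 1) / 2) = k%:Z -> box (l / 100) a c -> norm_inf (a - c) <= (k %/ 100)%:Z.
Proof.
move=> fl; rewrite /box /=; set z := norm_inf _ => zl.
have : (l - 1) / 2 < (k%:Z + 1)%:~R by rewrite -fl floorD1_gt.
rewrite intrD => lk.
have : (z * 100)%:~R <= (k%:Z)%:~R :> R by rewrite intrM; lra.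
by rewrite ler_int; clear; lia.
Qed.

(** Side conditions on [r] and [J] for the estimates above; a lower bound on [r]
    follows from [k ^ 2 < (r + 1) ^ 3]. *)
Lemma large_scale (R : realType) (k r J : nat) :
  10 ^+ 19 <= k%:R :> R ->
  (r ^ 3 <= k ^ 2)%N -> (k ^ 2 < r.+1 ^ 3)%N -> (400 * (r * J) <= k)%N ->
  (k < 2 * 400 * (r * J))%N ->
  [/\ 20 * 50 ^+ 4 <= r%:R :> R, (512 <= r <= k %/ 10)%N,
      r%:R <= 800 ^+ 2 * (J ^ 2)%:R :> R & (J * r)%:R ^+ 2 <= r.+1%:R ^+ 3 :> R].
Proof.
move=> kbig rk kr Jk kJ.
have r50 : 20 * 50 ^+ 4 <= r%:R :> R.
  rewrite leNgt; apply/negP => rs.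
  have h1 : r.+1%:R <= 10 ^+ 9 :> R.
    by rewrite -natr1; move: rs; rewrite !exprS !expr0; lra.
  have h2 : r.+1%:R ^+ 3 <= (10 ^+ 9) ^+ 3 :> R by apply: exp_mono.
  have h3 : (10 ^+ 19) ^+ 2 <= k%:R ^+ 2 :> R by apply: exp_mono => //; rewrite exprn_ge0.
  move: kr; rewrite -(ltr_nat R) !natrX => h4.
  have h5 : (10 ^+ 9) ^+ 3 <= (10 ^+ 19) ^+ 2 :> R.
    by rewrite -!exprM ler_weXn2l//; lra.
  by have := lt_le_trans h4 (le_trans h2 (le_trans h5 h3)); rewrite ltxx.
have r512 : (512 <= r)%N.
  by rewrite -(ler_nat R); move: r50; rewrite !exprS !expr0; lra.
have J0 : (0 < J)%N.
  by move: kJ; case: J {Jk} => //; rewrite !muln0.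
have rJ : (r <= r * J)%N by rewrite leq_pmulr.
split => //.
- rewrite r512 leq_divRL//; apply: leq_trans Jk.
  by move: rJ; move: (r * J)%N => p; clear; lia.
- have x0 : 0 < r%:R ^+ 2 :> R by rewrite exprn_gt0// ltr0n; apply: leq_trans r512.
  rewrite -(ler_pM2l x0) -exprSr.
  have h : k%:R <= 800 * (r * J)%:R :> R by move: kJ; rewrite -(ltr_nat R) !natrM; lra.
  have h2 : k%:R ^+ 2 <= (800 * (r * J)%:R) ^+ 2 :> R by apply: exp_mono.
  move: rk; rewrite -(ler_nat R) !natrX => /le_trans; apply; apply: le_trans h2 _.
  by rewrite !exprMn natrM exprMn mulrCA.
- have h : (J * r)%:R ^+ 2 <= k%:R ^+ 2 :> R.
    apply: exp_mono => //; rewrite ler_nat mulnC; apply: leq_trans Jk.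
    by rewrite leq_pmull.
  apply: le_trans h _; rewrite -!natrX ler_nat; exact: ltnW.
Qed.

Lemma growth_factor_bound (R : realType) (Vbar : R) (k N : nat) :
  2 <= Vbar -> 1 <= k%:R :> R -> N%:R * 10 <= k%:R :> R ->
  2 <= Vbar * (2 * k%:R) /\
  1 + (4 * N)%:R * (4 * Vbar + 4) <= (Vbar * (2 * k%:R)) ^+ 2.
Proof.
move=> V2; rewrite natrM; have : 0 <= N%:R :> R by [].
set q := k%:R; set n := N%:R => n0 q1 nq.
have qV : 2 <= q * Vbar by nra.
split; first by lra.
apply: le_trans (_ : 1 + q * (4 * Vbar + 4) <= _); first by nra.
have -> : (Vbar * (2 * q)) ^+ 2 = 4 * ((q * Vbar) * (q * Vbar)) by ring.
have h2 : q * Vbar * (q * Vbar) >= 2 * (q * Vbar) by rewrite ler_pM2r//; lra.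
have h3 : q * Vbar >= q * 2 by rewrite ler_pM2l//; lra.
by lra.
Qed.

(** All growth exponents are at most linear in [k], hence dominated by the exponent
    of [delta] as soon as [alpha] exceeds an absolute constant. *)
Lemma energy_window_tiny (R : realType) (X alpha delta : R) (k N : nat) :
  2 <= X -> 5000 <= alpha -> 1 <= k%:R :> R -> N%:R * 10 <= k%:R :> R ->
  delta = X `^ (- (alpha * (2 * k%:R))) ->
  [/\ 0 < delta, delta <= 2^-1, forall q, (q <= 20 * N)%N -> delta <= (X ^+ 2) ^- q &
    delta * (X ^+ 2) ^+ (40 * 256 * N.*2) < 1].
Proof.
move=> X2 al k1 Nk dE.
have X1 : 1 <= X by lra.
have X0 : 0 < X by lra.
have N0 : 0 <= N%:R :> R by [].
have dX n : n%:R <= 10000 * k%:R :> R -> delta <= X ^- n.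
  move=> nk; rewrite dE powRN lef_pV2 ?posrE ?powR_gt0 ?exprn_gt0//.
  rewrite -powR_mulrn ?(ltW X0)//; apply: ler_powR => //.
  by apply: le_trans nk _; rewrite mulrA ler_wpM2r//; lra.
split.
- by rewrite dE powR_gt0.
- apply: le_trans (dX 1%N _) _; first by lra.
  by rewrite expr1 lef_pV2 ?posrE.
- move=> q qN; rewrite -exprM; apply: dX; rewrite natrM.
  have : q%:R <= 20 * N%:R :> R by rewrite -natrM ler_nat.
  by lra.
rewrite -exprM; set n := (2 * _)%N.
apply: le_lt_trans (_ : X ^- n.+1 * X ^+ n < _).
  rewrite ler_pM2r ?exprn_gt0//; apply: dX.
  by rewrite -natr1 /n !natrM -muln2 natrM; lra.
have Xn : X ^+ n != 0 by rewrite gt_eqF// exprn_gt0.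
by rewrite exprS invfM -mulrA mulVf// mulr1 invf_lt1//; lra.
Qed.

Lemma scale_exponent (R : realType) (k r : nat) :
  (0 < r)%N -> (k ^ 2 < r.+1 ^ 3)%N -> (2 * k%:R) `^ (2 / 3) <= 4 * r%:R :> R.
Proof.
move=> r0 kr; apply: pow_two_thirds; rewrite ?mulr_ge0//.
have h1 : k%:R ^+ 2 <= r.+1%:R ^+ 3 :> R by rewrite -!natrX ler_nat ltnW.
have h2 : r.+1%:R ^+ 3 <= (2 * r%:R) ^+ 3 :> R.
  by apply: exp_mono => //; rewrite -natrM ler_nat; move: r0; clear; lia.
move: h1 h2; rewrite !exprMn; set x := r%:R ^+ 3.
have : 0 <= x by rewrite exprn_ge0.
by rewrite !exprS !expr0; lra.
Qed.

(* The bound on the probability of the event is stated through a measurable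
   event contained in it, so that it does not rely on the value of [P] at a
   set that has not been shown to be measurable. *)
Theorem theorem1p5 (R : realType) :
  exists2 eps0 : R, 0 < eps0 &
  forall eps : R, 0 < eps -> eps < eps0 ->
  exists2 alpha : R, 1 < alpha &
  forall (d : measure_display) (T : measurableType d) (P : probability T R)
    (lambda0 Vbar : R) (V : int * int -> {RV P >-> R})
    (l : R) (a : int * int),
    0 <= lambda0 <= 8 ->
    2 <= Vbar ->
    bernoulli_potential Vbar V ->
    1 <= l ->
    alpha <= side_length l ->
    exists A : set T,
      [/\ measurable A,
          A `<=` unique_continuation V eps alpha lambda0 Vbar l a &
          ((1 - expR (- (eps * side_length l `^ (2 / 3))))%:E <= P A)%E].
Proof.
exists (10 ^- 8) => [|eps eps0 eps1]; first by rewrite invr_gt0 exprn_gt0.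
exists (10 ^+ 20) => [|d T P lambda0 Vbar V l a l08 V2 bern l1 aL].
  by rewrite exprn_egt1//; lra.
have alpha5 : 5000 <= 10 ^+ 20 :> R.
  apply: le_trans (_ : 10 ^+ 4 <= _); first by rewrite !exprS expr0; lra.
  by rewrite ler_weXn2l//; lra.
have [k fl] : exists k : nat, Num.floor ((l - 1) / 2) = k%:Z.
  have : 0 <= Num.floor ((l - 1) / 2) by rewrite floor_ge0; lra.
  by case: (Num.floor _) => // k _; exists k.
have LE : side_length l = 2 * k%:R by rewrite /side_length fl intrM.
rewrite LE in aL *.
have kbig : 10 ^+ 19 <= k%:R :> R.
  have t0 : 0 <= 10 ^+ 19 :> R by rewrite exprn_ge0.
  by move: aL; rewrite exprS; lra.
have k1 : 1 <= k%:R :> R.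
  by apply: le_trans kbig; rewrite exprn_ege1// ler1n.
have [r [J [rk kr Jk kJ]]] : exists r J, [/\ (r ^ 3 <= k ^ 2)%N, (k ^ 2 < r.+1 ^ 3)%N,
    (400 * (r * J) <= k)%N & (k < 2 * 400 * (r * J))%N].
  apply: choose_scale => //; rewrite -(ler_nat R) natrX; apply: le_trans kbig.
  apply: le_trans (_ : (10 ^+ 3) ^+ 3 <= _).
    by apply: exp_mono => //; rewrite !exprS expr0; clear; lra.
  by rewrite -exprM ler_weXn2l// ler1n.
have [r50 r5N rJ2 Jr] := large_scale kbig rk kr Jk kJ.
pose N := (k %/ 10)%N.
pose X : R := Vbar * (2 * k%:R).
pose delta := X `^ (- (10 ^+ 20 * (2 * k%:R))).
pose G := X ^+ 2.
have Nk : N%:R * 10 <= k%:R :> R by rewrite -natrM ler_nat leq_divM.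
have [X2 G1] := growth_factor_bound V2 k1 Nk.
have [d0 d2 dG dGlt] := energy_window_tiny X2 alpha5 k1 Nk (erefl delta).
have [r5 rN] := andP r5N.
have k5 : (512 <= k %/ 10)%N := leq_trans r5 rN.
pose E := config_fails Vbar lambda0 delta G (box_fset a k) a r J N.
have V0 : Vbar != 0 by rewrite gt_eqF// (lt_le_trans _ V2).
exists (\bigcup_(w in [set` ~: E]) cylinder V Vbar w); split.
- apply: fin_bigcup_measurable => // w _; exact: measurable_cylinder.
- move=> t [w /= wE tw]; rewrite /unique_continuation /= LE => lambda u.
  have wE' : w \notin E by move: wE; rewrite inE.
  apply: (good_event eps0 (ltW eps1) (fun c => box_radius a c fl)
    (fun c => @small_box_radius _ _ _ a c fl) V2 l08 k5 r5 Jk kJ G1 d0 d2 dGlt wE').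
  by move=> c ck; apply: tw; rewrite /= in_box_fset.
rewrite prob_good_configs// lee_fin lerD2l lerN2.
apply: le_trans (pr_config_fails r5N V2 l08 G1 (ltW d0) dG _) _.
  move=> j i c h; rewrite in_box_fset.
  have := block_site_ball_box Jk (ltn_ord _) (ltn_ord _) (ltn_ord _) (ltn_ord _) h.
  by move=> h'; apply: le_trans h' _; rewrite lez_nat /N; clear; lia.
apply: le_trans (failure_asymptotics eps0 (ltW eps1) r50 rJ2 Jr) _.
rewrite ler_expR lerN2 ler_pM2l//; apply: scale_exponent => //.
by apply: leq_trans r5.
Qed.
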